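(* Let $G$ be either (1) a compact Lie group $G\subset U_N$, or (2) a finite quantum group (i.e. a compact matrix quantum group with $\dim C(G)<\infty$). Then $C(G)$ has an algebraic stationary model: there exist $K\in\mathbb N$, a compact Lie group $H$ endowed with its Haar probability measure, and an injective morphism of $C^*$-algebras $\pi:C(G)\to M_K(C(H))$ such that $\int_G=(tr\otimes\int_H)\pi$.
   Context: A compact matrix quantum group $G$ is given by a unital $C^*$-algebra $A=C(G)$, generated by the entries of a unitary matrix $u\in M_N(A)$, such that the formulae $\Delta(u_{ij})=\sum_ku_{ik}\otimes u_{kj}$, $\varepsilon(u_{ij})=\delta_{ij}$, $S(u_{ij})=u_{ji}^*$ define morphisms of $C^*$-algebras $\Delta:A\to A\otimes A$, $\varepsilon:A\to\mathbb C$, $S:A\to A^{opp}$. The functional $\int_G$ is the Haar state of $C(G)$. A compact Lie group $G\subset U_N$ is viewed as a compact matrix quantum group via its usual algebra $C(G)$ of continuous functions and its standard coordinates. Finite groups (including the trivial group) count as compact Lie groups. On $M_K(C(H))$, $tr\otimes\int_H$ denotes $f\mapsto\int_Htr(f(x))\,dx$, with $tr$ the normalized trace on $M_K(\mathbb C)$. *)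

(* Defs.v *)
From HB Require Import structures.
From mathcomp Require Import all_boot all_order all_algebra.
From mathcomp Require Import complex.
From mathcomp Require Import all_classical all_reals all_analysis.

Set Implicit Arguments.
Unset Strict Implicit.
Unset Printing Implicit Defensive.

Import Order.TTheory GRing.Theory Num.Theory numFieldNormedType.Exports.

Local Open Scope classical_set_scope.
Local Open Scope ring_scope.

(* The usual topology of the complex numbers R[i]. *)
HB.instance Definition _ (R : realType) := PseudoPointedMetric.copy R[i] R[i]^o.

Fact conj_continuous (C : numClosedFieldType) :
  continuous (fun z : C^o => z^* : C^o).
Proof.
move=> z; apply/(@cvgrPdist_lt C C^o C^o (nbhs z)) => e e0; near=> t.
rewrite -rmorphB norm_conjC; near: t.
exact: (@cvgr_dist_lt C C^o C^o (nbhs z) _ id z (@cvg_id _ _) e e0).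
Unshelve. all: by end_near. Qed.

(** * Star-algebras and C*-algebras (always unital) *)

HB.mixin Record isStarAlgebra (C : numClosedFieldType) A
    of GRing.Algebra C A := {
  star : A -> A;
  starK : involutive star;
  starD : {morph star : x y / x + y};
  starM : forall x y, star (x * y) = star y * star x;
  starZ : forall (c : C) x, star (c *: x) = c^* *: star x
}.

#[short(type="starAlgType")]
HB.structure Definition StarAlgebra (C : numClosedFieldType) :=
  {A of GRing.Algebra C A & isStarAlgebra C A}.

(* The norm takes its values in C, as norms of normed spaces over C do; by its
   axioms it is nonnegative, hence real. It is a separate field because
   Hierarchy Builder refuses a structure that is both a ring and a normedModType
   (the join would have to lie below numDomainType); the normed space itself is
   the alias cstar_space A. *)
HB.mixin Record isCStarAlgebra (C : numClosedFieldType) A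
    of StarAlgebra C A := {
  cstar_norm : A -> C;
  cstar_normD : forall x y, cstar_norm (x + y) <= cstar_norm x + cstar_norm y;
  cstar_normZ : forall (c : C) x, cstar_norm (c *: x) = `|c| * cstar_norm x;
  cstar_norm0_eq0 : forall x, cstar_norm x = 0 -> x = 0;
  cstar_normM : forall x y, cstar_norm (x * y) <= cstar_norm x * cstar_norm y;
  cstar_identity : forall x, cstar_norm (star x * x) = cstar_norm x ^+ 2;
  cstar_complete : forall u : nat -> A,
    (forall e : C, 0 < e -> exists N : nat, forall m n : nat,
      (N <= m)%N -> (N <= n)%N -> cstar_norm (u m - u n) < e) ->
    exists l : A, forall e : C, 0 < e -> exists N : nat, forall n : nat,
      (N <= n)%N -> cstar_norm (u n - l) < e
}.

#[short(type="cstarAlgType")]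
HB.structure Definition CStarAlgebra (C : numClosedFieldType) :=
  {A of StarAlgebra C A & isCStarAlgebra C A}.

Definition cstar_space (C : numClosedFieldType) (A : cstarAlgType C) : Type := A.

HB.instance Definition _ (C : numClosedFieldType) (A : cstarAlgType C) :=
  GRing.Lmodule.copy (cstar_space A) A.

HB.instance Definition _ (C : numClosedFieldType) (A : cstarAlgType C) :=
  Lmodule_isNormed.Build C (cstar_space A)
    (@cstar_normD C A) (@cstar_normZ C A) (@cstar_norm0_eq0 C A).

(* M^* for a matrix M over a star-algebra. *)
Definition adjmx (C : numClosedFieldType) (A : starAlgType C) (m n : nat)
  (M : 'M[A]_(m, n)) : 'M[A]_(n, m) := map_mx star M^T.

(* The star-algebra M_K(A) with K = k + 1. A type of its own, because
   'M[A]_K is already a module over A, and M_K(A) is to be one over C. *)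
Definition mxalg (C : numClosedFieldType) (A : starAlgType C) (k : nat) : Type :=
  'M[A]_k.+1.

Section mxalg.
Context (C : numClosedFieldType) (A : starAlgType C) (k : nat).
Local Notation M := (mxalg A k).

HB.instance Definition _ := GRing.NzRing.copy M 'M[A]_k.+1.

Definition mxalg_scale (c : C) (x : M) : M := map_mx (fun a : A => c *: a) x.

Fact mxalg_scaleA a b (x : M) :
  mxalg_scale a (mxalg_scale b x) = mxalg_scale (a * b) x.
Proof. by apply/matrixP => i j; rewrite !mxE scalerA. Qed.

Fact mxalg_scale1 : left_id 1 mxalg_scale.
Proof. by move=> x; apply/matrixP => i j; rewrite !mxE scale1r. Qed.

Fact mxalg_scaleDr : right_distributive mxalg_scale +%R.
Proof. by move=> c x y; apply/matrixP => i j; rewrite !mxE scalerDr. Qed.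

Fact mxalg_scaleDl (x : M) :
  {morph mxalg_scale^~ x : a b / a + b}.
Proof. by move=> a b; apply/matrixP => i j; rewrite !mxE scalerDl. Qed.

HB.instance Definition _ := GRing.Zmodule_isLmodule.Build C M
  mxalg_scaleA mxalg_scale1 mxalg_scaleDr mxalg_scaleDl.

Fact mxalg_scaleAl (c : C) (x y : M) : c *: (x * y) = (c *: x) * y.
Proof.
apply/matrixP => i j; rewrite !mxE scaler_sumr.
by apply: eq_bigr => l _; rewrite mxE scalerAl.
Qed.

HB.instance Definition _ := GRing.Lmodule_isLalgebra.Build C M mxalg_scaleAl.

Fact mxalg_scaleAr (c : C) (x y : M) : c *: (x * y) = x * (c *: y).
Proof.
apply/matrixP => i j; rewrite !mxE scaler_sumr.
by apply: eq_bigr => l _; rewrite mxE scalerAr.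
Qed.

HB.instance Definition _ := GRing.Lalgebra_isAlgebra.Build C M mxalg_scaleAr.

Definition mxalg_star (x : M) : M := adjmx x.

Fact mxalg_starK : involutive mxalg_star.
Proof. by move=> x; apply/matrixP => i j; rewrite !mxE starK. Qed.

Fact mxalg_starD : {morph mxalg_star : x y / x + y}.
Proof. by move=> x y; apply/matrixP => i j; rewrite !mxE starD. Qed.

Fact mxalg_starM (x y : M) : mxalg_star (x * y) = mxalg_star y * mxalg_star x.
Proof.
apply/matrixP => i j; rewrite !mxE.
have star0 : star (0 : A) = 0.
  by apply: (@addrI _ (star 0)); rewrite -starD !addr0.
rewrite (big_morph _ (@starD _ A) star0).
by apply: eq_bigr => l _; rewrite starM !mxE.
Qed.

Fact mxalg_starZ (c : C) (x : M) : mxalg_star (c *: x) = c^* *: mxalg_star x.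
Proof. by apply/matrixP => i j; rewrite !mxE starZ. Qed.

HB.instance Definition _ := isStarAlgebra.Build C M
  mxalg_starK mxalg_starD mxalg_starM mxalg_starZ.

End mxalg.

(** * Compact Lie groups, as compact subgroups of U_N *)

(* Compact subgroups of U_N are Lie groups by Cartan's theorem, and every compact
   Lie group is isomorphic to one by the Peter-Weyl theorem. *)

Record unitaryGroup (R : realType) (N : nat) := UnitaryGroup {
  ug_set : set 'M[R[i]]_N;
  ug_unitary : forall x, ug_set x -> x \is unitarymx;
  ug_one : ug_set 1%:M;
  ug_mulmx : forall x y, ug_set x -> ug_set y -> ug_set (x *m y);
  ug_invmx : forall x, ug_set x -> ug_set (invmx x);
  ug_compact : compact ug_set
}.

Definition ug_elt (R : realType) (N : nat) (G : unitaryGroup R N) : Type :=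
  set_type (ug_set G).

Coercion ug_elt : unitaryGroup >-> Sortclass.

Section unitaryGroup.
Context (R : realType) (N : nat) (G : unitaryGroup R N).

HB.instance Definition _ := Topological.copy G (set_type (ug_set G)).

Definition ug1 : G := SigSub (mem_set (ug_one G)).

HB.instance Definition _ := isPointed.Build G ug1.

Definition ug_mul (x y : G) : G :=
  SigSub (mem_set (ug_mulmx (set_valP x) (set_valP y))).

Definition borel : Type := g_sigma_algebraType (@open G).

HB.instance Definition _ := Measurable.copy borel (g_sigma_algebraType (@open G)).

End unitaryGroup.

(* A compact group comes with its Haar probability measure as part of the data:
   it exists and is unique, but the library does not construct it. *)
Record haarGroup (R : realType) (N : nat) := HaarGroup {
  hg_group :> unitaryGroup R N;
  haar : probability (borel hg_group) R;
  haar_inv : forall (x : hg_group) (B : set (borel hg_group)),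
    measurable B -> haar (ug_mul x @^-1` B) = haar B
}.

(** * The algebra C(G) of continuous functions on a compact Lie group *)

Definition cfun (R : realType) (N : nat) (G : unitaryGroup R N) : Type :=
  continuousType G R[i].

Section cfun.
Context (R : realType) (N : nat) (G : unitaryGroup R N).
Local Notation A := (cfun G).

HB.instance Definition _ := Choice.copy A (continuousType G R[i]).

Definition cfun_fun (f : A) : G -> R[i] := f : continuousType G R[i].

Coercion cfun_fun : cfun >-> Funclass.

Definition mkcfun (f : G -> R[i]) (fc : continuous f) : A :=
  (mkcts fc : continuousType G R[i]).

Fact cfunP (f g : A) : (forall x, f x = g x) -> f = g.
Proof. by move=> fg; apply/continuousEP => x; exact: fg. Qed.

Fact cfun_continuous (f : A) : continuous f.
Proof. exact: (@cts_fun _ _ (f : continuousType G R[i])). Qed.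

Fact cfun_cst_continuous (c : R[i]) : continuous (fun _ : G => c).
Proof. by move=> x; exact: (@cst_continuous G R[i] c). Qed.

Fact cfun_add_continuous (f g : A) : continuous (fun x => f x + g x).
Proof.
move=> x.
exact: (@cvgD R[i] R[i]^o G (nbhs x) _ f g _ _
  (@cfun_continuous f x) (@cfun_continuous g x)).
Qed.

Fact cfun_opp_continuous (f : A) : continuous (fun x => - f x).
Proof.
move=> x.
exact: (@cvgN R[i] R[i]^o G (nbhs x) _ f _ (@cfun_continuous f x)).
Qed.

Fact cfun_mul_continuous (f g : A) : continuous (fun x => f x * g x).
Proof.
move=> x.
exact: (@cvgM R[i] G (nbhs x) _ f g _ _
  (@cfun_continuous f x) (@cfun_continuous g x)).
Qed.

Fact cfun_conj_continuous (f : A) : continuous (fun x => (f x)^*).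
Proof.
move=> x; apply: (@continuous_comp G R[i] R[i] f (fun z => z^*)).
  exact: cfun_continuous.
exact: (@conj_continuous R[i]).
Qed.

Definition cfun_cst c := mkcfun (@cfun_cst_continuous c).
Definition cfun_add f g := mkcfun (@cfun_add_continuous f g).
Definition cfun_opp f := mkcfun (@cfun_opp_continuous f).
Definition cfun_mul f g := mkcfun (@cfun_mul_continuous f g).
Definition cfun_scale c f := cfun_mul (cfun_cst c) f.
Definition cfun_star f := mkcfun (@cfun_conj_continuous f).

Fact cfun_addA : associative cfun_add.
Proof. by move=> f g h; apply: cfunP => x; exact: addrA. Qed.
Fact cfun_addC : commutative cfun_add.
Proof. by move=> f g; apply: cfunP => x; exact: addrC. Qed.
Fact cfun_add0 : left_id (cfun_cst 0) cfun_add.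
Proof. by move=> f; apply: cfunP => x; exact: add0r. Qed.
Fact cfun_addN : left_inverse (cfun_cst 0) cfun_opp cfun_add.
Proof. by move=> f; apply: cfunP => x; exact: addNr. Qed.

HB.instance Definition _ := GRing.isZmodule.Build A
  cfun_addA cfun_addC cfun_add0 cfun_addN.

Fact cfun_mulA : associative cfun_mul.
Proof. by move=> f g h; apply: cfunP => x; exact: mulrA. Qed.
Fact cfun_mulC : commutative cfun_mul.
Proof. by move=> f g; apply: cfunP => x; exact: mulrC. Qed.
Fact cfun_mul1 : left_id (cfun_cst 1) cfun_mul.
Proof. by move=> f; apply: cfunP => x; exact: mul1r. Qed.
Fact cfun_mulDl : left_distributive cfun_mul +%R.
Proof. by move=> f g h; apply: cfunP => x; exact: mulrDl. Qed.
Fact cfun_1neq0 : cfun_cst 1 != 0.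
Proof.
apply/eqP => /(congr1 (fun f : A => f (ug1 G))) /eqP.
by rewrite [_ == _]oner_eq0.
Qed.

HB.instance Definition _ := GRing.Zmodule_isComNzRing.Build A
  cfun_mulA cfun_mulC cfun_mul1 cfun_mulDl cfun_1neq0.

Fact cfun_scaleA a b f : cfun_scale a (cfun_scale b f) = cfun_scale (a * b) f.
Proof. by apply: cfunP => x; exact: mulrA. Qed.
Fact cfun_scale1 : left_id 1 cfun_scale.
Proof. by move=> f; apply: cfunP => x; exact: mul1r. Qed.
Fact cfun_scaleDr : right_distributive cfun_scale +%R.
Proof. by move=> c f g; apply: cfunP => x; exact: mulrDr. Qed.
Fact cfun_scaleDl (f : A) : {morph cfun_scale^~ f : a b / a + b}.
Proof. by move=> a b; apply: cfunP => x; exact: mulrDl. Qed.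

HB.instance Definition _ := GRing.Zmodule_isLmodule.Build R[i] A
  cfun_scaleA cfun_scale1 cfun_scaleDr cfun_scaleDl.

Fact cfun_scaleAl (c : R[i]) (f g : A) : c *: (f * g) = (c *: f) * g.
Proof. by apply: cfunP => x; exact: mulrA. Qed.

HB.instance Definition _ := GRing.Lmodule_isLalgebra.Build R[i] A cfun_scaleAl.

Fact cfun_scaleAr (c : R[i]) (f g : A) : c *: (f * g) = f * (c *: g).
Proof. by apply: cfunP => x; exact: mulrCA. Qed.

HB.instance Definition _ := GRing.Lalgebra_isAlgebra.Build R[i] A cfun_scaleAr.

Fact cfun_starK : involutive cfun_star.
Proof. by move=> f; apply: cfunP => x; exact: conjCK. Qed.
Fact cfun_starD : {morph cfun_star : f g / f + g}.
Proof. by move=> f g; apply: cfunP => x; exact: rmorphD. Qed.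
Fact cfun_starM (f g : A) : cfun_star (f * g) = cfun_star g * cfun_star f.
Proof.
by rewrite [RHS]mulrC; apply: cfunP => x; exact: rmorphM.
Qed.
Fact cfun_starZ (c : R[i]) (f : A) : cfun_star (c *: f) = c^* *: cfun_star f.
Proof. by apply: cfunP => x; exact: rmorphM. Qed.

HB.instance Definition _ := isStarAlgebra.Build R[i] A
  cfun_starK cfun_starD cfun_starM cfun_starZ.

End cfun.

(** * Tensor products and compact matrix quantum groups *)

(* T, together with tens a b = a (x) b, is a completion of the algebraic tensor
   product of A and B for some C*-norm. Which C*-norm is used makes no
   difference when A or B is commutative or finite dimensional. *)
Record cstar_tensor (C : numClosedFieldType) (A B T : cstarAlgType C)
    (tens : A -> B -> T) : Prop := CstarTensor {
  tensDl : forall a a' b, tens (a + a') b = tens a b + tens a' b;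
  tensDr : forall a b b', tens a (b + b') = tens a b + tens a b';
  tensZl : forall (c : C) a b, tens (c *: a) b = c *: tens a b;
  tensZr : forall (c : C) a b, tens a (c *: b) = c *: tens a b;
  tensM : forall a a' b b', tens a b * tens a' b' = tens (a * a') (b * b');
  tens1 : tens 1 1 = 1;
  tens_star : forall a b, star (tens a b) = tens (star a) (star b);
  (* the algebraic tensor product embeds into T *)
  tens_free : forall (n : nat) (a : 'I_n -> A) (b : 'I_n -> B),
    (forall c : 'I_n -> C, \sum_i c i *: a i = 0 -> forall i, c i = 0) ->
    \sum_i tens (a i) (b i) = 0 -> forall i, b i = 0;
  tens_dense : closure [set t : cstar_space T | exists (n : nat) (a : 'I_n -> A) (b : 'I_n -> B),
    t = \sum_i tens (a i) (b i)] = setT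
}.

Record star_subalgebra (C : numClosedFieldType) (A : starAlgType C)
    (B : set A) : Prop := StarSubalgebra {
  star_subalg1 : B 1;
  star_subalgD : forall x y, B x -> B y -> B (x + y);
  star_subalgM : forall x y, B x -> B y -> B (x * y);
  star_subalgZ : forall (c : C) x, B x -> B (c *: x);
  star_subalg_star : forall x, B x -> B (star x)
}.

Record cmqg (R : realType) (N : nat) := CMQG {
  qalg :> cstarAlgType R[i];
  qu : 'M[qalg]_N;
  qu_unitaryr : qu *m adjmx qu = 1%:M;
  qu_unitaryl : adjmx qu *m qu = 1%:M;
  qu_generate : forall B : set qalg, star_subalgebra B ->
    closed (B : set (cstar_space qalg)) -> (forall i j, B (qu i j)) -> B = setT;
  qalg2 : cstarAlgType R[i];
  qtens : qalg -> qalg -> qalg2;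
  qtensP : cstar_tensor qtens;
  qDelta : {lrmorphism qalg -> qalg2};
  qDelta_star : {morph qDelta : a / star a};
  qDelta_u : forall i j, qDelta (qu i j) = \sum_k qtens (qu i k) (qu k j);
  qeps : {lrmorphism qalg -> R[i]^o};
  qeps_star : forall a, qeps (star a) = (qeps a)^*;
  qeps_u : forall i j, qeps (qu i j) = (i == j)%:R;
  (* a morphism into the opposite algebra *)
  qS : {linear qalg -> qalg};
  qS1 : qS 1 = 1;
  qSM : forall a b, qS (a * b) = qS b * qS a;
  qS_star : {morph qS : a / star a};
  qS_u : forall i j, qS (qu i j) = star (qu j i)
}.

(* h is the Haar state: (h (x) id) Delta = h(.) 1 = (id (x) h) Delta, where
   h (x) id is the continuous linear map E with E (a (x) b) = h(a) b. *)
Record haar_state (R : realType) (N : nat) (G : cmqg R N)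
    (h : {scalar G}) : Prop := HaarState {
  haar_state_ge0 : forall a : G, 0 <= h (star a * a);
  haar_state1 : h 1 = 1;
  haar_state_l : exists E : {linear qalg2 G -> G},
    [/\ continuous (E : cstar_space (qalg2 G) -> cstar_space G),
        forall a b, E (qtens a b) = h a *: b
      & forall a, E (qDelta G a) = h a *: 1];
  haar_state_r : exists E : {linear qalg2 G -> G},
    [/\ continuous (E : cstar_space (qalg2 G) -> cstar_space G),
        forall a b, E (qtens a b) = h b *: a
      & forall a, E (qDelta G a) = h a *: 1]
}.

(* G is a compact Lie group L in U_N: C(G) = C(L), and u_ij is the function
   x |-> x_ij on L. *)
Definition is_compact_lie (R : realType) (N : nat) (G : cmqg R N) : Prop :=
  exists (L : haarGroup R N) (theta : {lrmorphism G -> cfun L}),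
    [/\ {morph theta : a / star a >-> star a}, bijective theta
      & forall i j (x : L), theta (qu G i j) x = set_val x i j].

Definition is_finite_qg (R : realType) (N : nat) (G : cmqg R N) : Prop :=
  exists (n : nat) (e : 'I_n -> G),
    forall a : G, exists c : 'I_n -> R[i], a = \sum_i c i *: e i.

(** * Stationary models *)

Definition cintegral (R : realType) (d : measure_display) (T : measurableType d)
    (mu : {measure set T -> \bar R}) (f : T -> R[i]) : R[i] :=
  Complex (Rintegral mu setT (fun x => complex.Re (f x)))
          (Rintegral mu setT (fun x => complex.Im (f x))).

(* The functional tr (x) int_H on M_K(C(H)), where K = k + 1. *)
Definition tr_haar (R : realType) (M : nat) (H : haarGroup R M) (k : nat)
    (f : mxalg (cfun H) k) : R[i] :=
  cintegral (haar H)
    (fun x => k.+1%:R^-1 * \tr (map_mx (fun g : cfun H => g x) f)).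

Definition has_algebraic_stationary_model (R : realType) (A : cstarAlgType R[i])
    (h : A -> R[i]) : Prop :=
  exists (k M : nat) (H : haarGroup R M) (pi : {lrmorphism A -> mxalg (cfun H) k}),
    [/\ {morph pi : a / star a >-> star a}, injective pi
      & forall a, h a = tr_haar (pi a)].

(* Main.v *)
(* Compact Lie case: the model is C(G) = C(L) itself, with K = 1, and the point is
   that h is the integral I over L. If Delta a is a finite sum of x (x) y, as
   holds for the a in the *-algebra generated by the u_ij, then left invariance of
   the Haar measure gives \sum I(y) x = I(a) 1, hence
   I(a) = \sum h(x) I(y) = I((h (x) id) (Delta a)) = h(a). One concludes by
   density, as h and I are both bounded.

   Finite case: H is the trivial group and the model is the regular
   representation in a basis e_1, ..., e_K orthonormal for <a, b> = h(a^* b). One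
   has to show that h is faithful, so that such a basis exists, and that h is the
   normalized trace of the regular representation. The latter follows from
   \sum_i e_i^* e_i = K: this identity expresses K h as a trace, hence h is
   tracial, hence (e_i^* )_i is orthonormal too and \sum_i e_i e_i^* = K. *)

Require Import Defs.
From HB Require Import structures.
From mathcomp Require Import all_boot all_order all_algebra.
From mathcomp Require Import complex.
From mathcomp Require Import ring.
From mathcomp Require Import all_classical all_reals all_analysis.

Set Implicit Arguments.
Unset Strict Implicit.
Unset Printing Implicit Defensive.

Import Order.TTheory GRing.Theory Num.Theory numFieldNormedType.Exports.

Local Open Scope classical_set_scope.
Local Open Scope ring_scope.

(** * C*-norms and characters *)

Section cstar_norm_theory.
Context (C : numClosedFieldType) (A : cstarAlgType C).
Implicit Types (x y a : A).

Lemma cstar_norm_ge0 x : 0 <= cstar_norm x.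
Proof. exact: (@normr_ge0 _ (cstar_space A)). Qed.

Lemma cstar_norm0 : cstar_norm (0 : A) = 0.
Proof. exact: (@normr0 _ (cstar_space A)). Qed.

Lemma cstar_normN x : cstar_norm (- x) = cstar_norm x.
Proof. exact: (@normrN _ (cstar_space A)). Qed.

Lemma cstar_distC x y : cstar_norm (x - y) = cstar_norm (y - x).
Proof. by rewrite -cstar_normN opprB. Qed.

Lemma cstar_dist_triangle z x y :
  cstar_norm (x - y) <= cstar_norm (x - z) + cstar_norm (z - y).
Proof. by apply: le_trans (cstar_normD _ _); rewrite addrA subrK. Qed.

Lemma cstar_norm_small x : (forall e : C, 0 < e -> cstar_norm x < e) -> x = 0.
Proof.
move=> small; apply: cstar_norm0_eq0; apply/eqP; apply: contraT => x0.
by have := small (cstar_norm x); rewrite lt0r x0 cstar_norm_ge0 ltxx => /(_ isT).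
Qed.

End cstar_norm_theory.

(** The order of [R[i]] only compares numbers with equal imaginary parts. Norms and tolerances with
    values in [R[i]] thus descend to [R]. *)
Lemma real_complex_ge0 (R : realType) (z : R[i]) :
  0 <= z -> exists2 r : R, 0 <= r & z = r%:C%C.
Proof.
case: z => a b; rewrite lecE /= => /andP[/eqP b0 a0].
by exists a => //; rewrite b0.
Qed.

Lemma expr_small (R : realType) (r e : R[i]) : 0 <= r -> r < 1 -> 0 < e ->
  exists N : nat, forall n, (N <= n)%N -> r ^+ n < e.
Proof.
move=> /real_complex_ge0[{}r r0 ->] r1 e0.
have [e' _ ee] := real_complex_ge0 (ltW e0).
move: e0 r1; rewrite ee !ltcR => e0 r1.
have : `|r| < 1 by rewrite ger0_norm.
move=> /cvg_expr/cvgrPdist_lt/(_ _ e0)[N _ HN].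
exists N => n /HN /=; rewrite sub0r normrN -rmorphXn ltcR.
by apply: le_lt_trans; exact: ler_norm.
Qed.

Section characters.
Context (R : realType) (A : cstarAlgType R[i]).

Lemma geometric_cauchy (a : A) : cstar_norm a < 1 -> forall e : R[i], 0 < e ->
  exists N : nat, forall m n : nat, (N <= m)%N -> (N <= n)%N ->
    cstar_norm (\sum_(i < m) a ^+ i - \sum_(i < n) a ^+ i) < e.
Proof.
move=> a1 e e0; set r := cstar_norm a in a1 *.
have r0 : 0 <= r by exact: cstar_norm_ge0.
have r1 : 0 < 1 - r by rewrite subr_gt0.
set c := cstar_norm (1 : A).
have c0 : 0 <= c by exact: cstar_norm_ge0.
have aX n : cstar_norm (a ^+ n) <= c * r ^+ n.
  elim: n => [|n IH]; first by rewrite !expr0 mulr1.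
  rewrite exprSr (le_trans (cstar_normM _ _))// exprSr mulrA.
  exact: ler_wpM2r.
have tail m k : cstar_norm (\sum_(i < m + k) a ^+ i - \sum_(i < m) a ^+ i) * (1 - r)
    <= c * r ^+ m.
  (* The telescoping bound with [r ^+ m - r ^+ (m + k)] passes through the induction on [k], which
     the weaker bound would not. Multiplying by [1 - r] avoids a division. *)
  suff H : cstar_norm (\sum_(i < m + k) a ^+ i - \sum_(i < m) a ^+ i) * (1 - r)
    <= c * (r ^+ m - r ^+ (m + k)).
    apply: (le_trans H); apply: ler_wpM2l => //.
    by rewrite gerBl exprn_ge0.
  elim: k => [|k IH]; first by rewrite addn0 !subrr cstar_norm0 mul0r mulr0.
  rewrite addnS big_ord_recr/= addrAC.
  apply: (le_trans (ler_wpM2r (ltW r1) (cstar_normD _ _))).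
  rewrite mulrDl; apply: le_trans (lerD IH (ler_wpM2r (ltW r1) (aX _))) _.
  by rewrite -mulrA -mulrDr mulrBr mulr1 addrA subrK exprSr.
(* Adding 1 to [c] keeps the denominator positive; the bound [c * r ^+ m] then stays below
   [e * (1 - r)]. *)
have e'0 : 0 < e * (1 - r) / (c + 1).
  by rewrite divr_gt0 ?mulr_gt0// ltr_wpDl.
have [N HN] := expr_small r0 a1 e'0.
exists N => m n Nm Nn; wlog mn : m n Nm Nn / (m <= n)%N.
  move=> wl; have [|/ltnW] := leqP m n; first exact: wl.
  by rewrite cstar_distC; exact: wl.
rewrite cstar_distC -(ltr_pM2r r1) -(subnKC mn).
apply: (le_lt_trans (tail _ _)).
have := HN _ Nm; rewrite ltr_pdivlMr ?ltr_wpDl//.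
by apply: le_lt_trans; rewrite mulrC ler_wpM2l ?exprn_ge0// lerDl.
Qed.

(* If [chi a = 1] and [|a| < 1], the sum [l] of the geometric series satisfies
   [l = 1 + a l], hence [chi l = 1 + chi l]. *)
Lemma character_bounded (chi : {lrmorphism A -> R[i]^o}) (a : A) :
  `|chi a| <= cstar_norm a.
Proof.
rewrite real_leNgt ?normr_real ?ger0_real ?cstar_norm_ge0//.
apply/negP => lt.
have ca0 : chi a != 0.
  by apply: contraTneq lt => ->; rewrite normr0 le_gtF ?cstar_norm_ge0.
(* Rescaling makes the character equal to 1 at [b] while the norm of [b] stays below 1. *)
pose b := (chi a)^-1 *: a.
have chib : chi b = 1 by rewrite linearZ /= [_ *: _]mulVf.
have b1 : cstar_norm b < 1.
  by rewrite cstar_normZ normfV mulrC ltr_pdivrMr ?normr_gt0// mul1r.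
have [l Hl] := cstar_complete _ (geometric_cauchy b1).
suff e : l - (1 + b * l) = 0.
  have /eqP : chi l = 1 + chi b * chi l.
    by rewrite {1}(subr0_eq e) rmorphD rmorph1 rmorphM.
  rewrite chib mul1r -subr_eq subrr.
  by rewrite eq_sym oner_eq0.
apply: cstar_norm_small => e e0.
have e20 : 0 < e / 2 by rewrite divr_gt0.
have [N HN] := Hl _ e20.
pose s n := \sum_(i < n) b ^+ i.
have sS : s N.+1 = 1 + b * s N.
  rewrite /s big_ord_recl expr0 mulr_sumr; congr (_ + _).
  by apply: eq_bigr => i _; rewrite exprS.
apply: le_lt_trans (cstar_dist_triangle (s N.+1) _ _) _.
rewrite [X in _ < X](splitr e) ltr_leD//.
  by rewrite cstar_distC HN.
rewrite sS opprD addrACA subrr add0r -mulrBr.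
apply: le_trans (cstar_normM _ _) _.
apply: le_trans (_ : cstar_norm (s N - l) <= _).
  by rewrite ler_piMl ?cstar_norm_ge0 ?ltW.
by rewrite ltW// HN.
Qed.

End characters.

(** * Closures and finite-dimensional subspaces *)

Section star_theory.
Context (C : numClosedFieldType) (A : starAlgType C).
Implicit Types x y : A.

Lemma star0 : star (0 : A) = 0.
Proof. by apply: (@addrI _ (star 0)); rewrite -starD !addr0. Qed.

Lemma starN x : star (- x) = - star x.
Proof. by apply/eqP; rewrite -addr_eq0 -starD addNr star0. Qed.

Lemma starB x y : star (x - y) = star x - star y.
Proof. by rewrite starD starN. Qed.

Lemma star1 : star (1 : A) = 1.
Proof. by rewrite -[star 1]mulr1 -{2}(starK 1) -starM mulr1 starK. Qed.

Lemma star_sum I (s : seq I) (F : I -> A) :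
  star (\sum_(i <- s) F i) = \sum_(i <- s) star (F i).
Proof. by rewrite (big_morph _ (@starD _ A) star0). Qed.

End star_theory.

Section cstar_closure.
Context (R : realType) (A : cstarAlgType R[i]).
Implicit Types (x y a : A) (P : set A).

Lemma cstar_closureP P x : closure (P : set (cstar_space A)) x <->
  (forall e : R[i], 0 < e -> exists2 p, P p & cstar_norm (x - p) < e).
Proof.
split=> [clx e e0|H].
  have [p [Pp xp]] := clx _ (nbhsx_ballx (x : cstar_space A) e e0).
  exists p => //; by move: xp; rewrite -ball_normE.
move=> B /nbhs_ballP[e /= e0 He]; have [p Pp xp] := H e e0.
by exists p; split => //; apply: He; rewrite -ball_normE.
Qed.

(** The C*-identity bounds the square of the norm of [y] by the product of the norms of [star y] and
    [y]. Dividing by the norm of [y] gives one inequality; the other is its instance at [star x]. *)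
Lemma cstar_norm_star x : cstar_norm (star x) = cstar_norm x.
Proof.
suff le y : cstar_norm y <= cstar_norm (star y).
  by apply/eqP; rewrite eq_le le -{2}(starK x) le.
have [->|y0] := eqVneq (cstar_norm y) 0; first exact: cstar_norm_ge0.
have yp : 0 < cstar_norm y by rewrite lt0r y0 cstar_norm_ge0.
by rewrite -(ler_pM2r yp) -expr2 -cstar_identity cstar_normM.
Qed.

Lemma closure_star_subalgebra P : star_subalgebra P ->
  star_subalgebra (closure (P : set (cstar_space A))).
Proof.
move=> [P1 PD PM PZ Ps].
have sub x : P x -> closure (P : set (cstar_space A)) x by exact: subset_closure.
split; first exact: sub.
- move=> x y /cstar_closureP Px /cstar_closureP Py; apply/cstar_closureP => e e0.
  have e20 : 0 < e / 2 by rewrite divr_gt0.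
  have [p Pp xp] := Px _ e20; have [q Pq yq] := Py _ e20.
  exists (p + q); first exact: PD.
  rewrite opprD addrACA (le_lt_trans (cstar_normD _ _))//.
  by rewrite [X in _ < X](splitr e) ltrD.
- move=> x y /cstar_closureP Px /cstar_closureP Py; apply/cstar_closureP => e e0.
  have ny := cstar_norm_ge0 y.
  (* [q] is chosen after [p], since its tolerance involves the norm of [p]: the error is split as (x
     - p) y + p (y - q). *)
  have [p Pp xp] := Px (e / 2 / (cstar_norm y + 1))
    (divr_gt0 (divr_gt0 e0 (ltr0n _ 2)) (ltr_wpDl ny ltr01)).
  have np := cstar_norm_ge0 p.
  have [q Pq yq] := Py (e / 2 / (cstar_norm p + 1))
    (divr_gt0 (divr_gt0 e0 (ltr0n _ 2)) (ltr_wpDl np ltr01)).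
  exists (p * q); first exact: PM.
  have -> : x * y - p * q = (x - p) * y + p * (y - q).
    by rewrite mulrBl mulrBr addrA subrK.
  rewrite (le_lt_trans (cstar_normD _ _))// [X in _ < X](splitr e) ltrD//.
    move: xp; rewrite ltr_pdivlMr ?ltr_wpDl//; apply: le_lt_trans.
    by rewrite (le_trans (cstar_normM _ _))// ler_wpM2l ?cstar_norm_ge0// lerDl.
  move: yq; rewrite ltr_pdivlMr ?ltr_wpDl//; apply: le_lt_trans.
  rewrite (le_trans (cstar_normM _ _))// mulrC ler_wpM2l ?cstar_norm_ge0//.
  by rewrite lerDl.
- move=> c x /cstar_closureP Px; apply/cstar_closureP => e e0.
  have nc := normr_ge0 c.
  have [p Pp xp] := Px _ (divr_gt0 e0 (ltr_wpDl nc ltr01)).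
  exists (c *: p); first exact: PZ.
  rewrite -scalerBr cstar_normZ.
  move: xp; rewrite ltr_pdivlMr ?ltr_wpDl//; apply: le_lt_trans.
  by rewrite mulrC ler_wpM2l ?cstar_norm_ge0// lerDl.
- move=> x /cstar_closureP Px; apply/cstar_closureP => e e0.
  have [p Pp xp] := Px _ e0; exists (star p); first exact: Ps.
  by rewrite -starB cstar_norm_star.
Qed.

End cstar_closure.

Section finite_dimensional.
Context (R : realType) (A : cstarAlgType R[i]) (chi : {lrmorphism A -> R[i]^o}).
Implicit Types (x y a : A) (P : set A).

(** The completeness of [A] is transferred to the scalars: the multiples [c n *: 1] converge in [A],
    and [chi], being bounded by the norm, maps their limit to a limit of [c]. *)
Lemma complex_complete (c : nat -> R[i]) :
  (forall e : R[i], 0 < e -> exists N : nat, forall m n : nat,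
    (N <= m)%N -> (N <= n)%N -> `|c m - c n| < e) ->
  exists l : R[i], forall e : R[i], 0 < e -> exists N : nat, forall n : nat,
    (N <= n)%N -> `|c n - l| < e.
Proof.
move=> cc; have n1 := cstar_norm_ge0 (1 : A).
have [|l Hl] := @cstar_complete _ A (fun n => c n *: 1).
  move=> e e0; have [N HN] := cc _ (divr_gt0 e0 (ltr_wpDl n1 ltr01)).
  exists N => m n Nm Nn; rewrite -scalerBl cstar_normZ.
  have := HN _ _ Nm Nn; rewrite ltr_pdivlMr ?ltr_wpDl//; apply: le_lt_trans.
  by rewrite ler_wpM2l// lerDl.
exists (chi l) => e e0; have [N HN] := Hl _ e0; exists N => n Nn.
apply: le_lt_trans (HN _ Nn).
apply: le_trans (character_bounded chi _).
by rewrite linearB linearZ /= rmorph1 [_ *: _]mulr1.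
Qed.

Lemma invS_small (e : R[i]) : 0 < e -> exists n : nat, n.+1%:R^-1 < e.
Proof.
move=> e0; have [r _ er] := real_complex_ge0 (ltW e0).
move: e0; rewrite er ltcR => /ltr_add_invr[n]; rewrite add0r => nr.
by exists n; rewrite -(rmorph_nat (real_complex R)) -fmorphV ltcR.
Qed.

(** If [x] lies outside the closed subspace [F], it has a positive distance [d] to [F], so the
    coefficient of [x] is bounded by the norm of [f + c *: x] divided by [d]. Along a convergent
    sequence the coefficients are then Cauchy, and subtracting their limit times [x] leads back into
    [F]. *)
Lemma closed_line (F : set A) (x : A) :
  F 0 -> (forall y z, F y -> F z -> F (y + z)) ->
  (forall (c : R[i]) y, F y -> F (c *: y)) ->
  closed (F : set (cstar_space A)) ->
  closed ([set z | exists y (c : R[i]), F y /\ z = y + c *: x]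
    : set (cstar_space A)).
Proof.
move=> F0 FD FZ clF.
have [Fx|Fx] := pselect (F x).
  suff -> : [set z | exists y c, F y /\ z = y + c *: x] = F by [].
  apply/seteqP; split => [z [y [c [Fy ->]]]|z Fz]; first by apply: FD => //; exact: FZ.
  by exists z, 0; rewrite scale0r addr0.
have [d d0 dF] : exists2 d : R[i], 0 < d & forall f, F f -> d <= cstar_norm (x - f).
  apply: contrapT => nd; apply: Fx; apply: clF; apply/cstar_closureP => e e0.
  apply: contrapT => ne; apply: nd; exists e => // f Ff.
  rewrite real_leNgt; first by apply/negP => fe; apply: ne; exists f.
    by rewrite ger0_real// ltW.
  by rewrite ger0_real// cstar_norm_ge0.
move=> z /cstar_closureP clz.
have dc (c : R[i]) f : F f -> `|c| * d <= cstar_norm (f + c *: x).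
  move=> Ff; have [->|c0] := eqVneq c 0.
    by rewrite normr0 mul0r cstar_norm_ge0.
  have -> : f + c *: x = c *: (x - (- c^-1) *: f).
    by rewrite scalerBr scalerA mulrN divff// scaleN1r opprK addrC.
  by rewrite cstar_normZ ler_wpM2l// dF//; exact: FZ.
have clz' n : exists fc : A * R[i],
    F fc.1 /\ cstar_norm (z - (fc.1 + fc.2 *: x)) < n.+1%:R^-1.
  have [|p [f [c [Ff ->]]] zp] := clz n.+1%:R^-1; first by rewrite invr_gt0.
  by exists (f, c).
have [fc Hfc] := choice clz'.
pose f n := (fc n).1; pose c n := (fc n).2.
have invle (n m : nat) : (n <= m)%N -> m.+1%:R^-1 <= n.+1%:R^-1 :> R[i].
  by move=> nm; rewrite lef_pV2 ?posrE// ler_nat.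
have [|l Hl] := @complex_complete c.
  move=> e e0; have [N HN] := invS_small (divr_gt0 (mulr_gt0 e0 d0) (ltr0n R[i] 2)).
  exists N => m n Nm Nn; rewrite -(ltr_pM2r d0).
  have Fmn : F (f m - f n).
    by apply: FD; [exact: (Hfc m).1|rewrite -scaleN1r; apply: FZ; exact: (Hfc n).1].
  apply: (le_lt_trans (dc _ _ Fmn)).
  have -> : f m - f n + (c m - c n) *: x =
      (z - (f n + c n *: x)) - (z - (f m + c m *: x)).
    by rewrite opprB [RHS]addrC subrKA scalerBl opprD addrACA.
  apply: (le_lt_trans (cstar_normD _ _)); rewrite cstar_normN.
  rewrite [X in _ < X]splitr ltrD//.
    by apply: lt_trans (lt_le_trans (Hfc n).2 (invle _ _ Nn)) _.
  by apply: lt_trans (lt_le_trans (Hfc m).2 (invle _ _ Nm)) _.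
exists (z - l *: x), l; split; last by rewrite subrK.
apply: clF; apply/cstar_closureP => e e0.
have nx := cstar_norm_ge0 x.
have e20 : 0 < e / 2 by rewrite divr_gt0.
have [N1 HN1] := invS_small e20.
have [N2 HN2] := Hl _ (divr_gt0 e20 (ltr_wpDl nx ltr01)).
pose n := maxn N1 N2.
exists (f n); first exact: (Hfc n).1.
have -> : z - l *: x - f n = (z - (f n + c n *: x)) + (c n - l) *: x.
  by rewrite scalerBl opprD !addrA subrK addrAC.
apply: (le_lt_trans (cstar_normD _ _)); rewrite [X in _ < X]splitr ltrD//.
  by apply: lt_trans (lt_le_trans (Hfc n).2 (invle _ _ (leq_maxl _ _))) _.
have := HN2 n (leq_maxr _ _); rewrite ltr_pdivlMr ?ltr_wpDl//; apply: le_lt_trans.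
by rewrite cstar_normZ ler_wpM2l// lerDl.
Qed.

(** Induction on the number of vectors. Let [S] be the span of all but the first. If [F] is not
    inside [S], any [p] in [F] outside [S] gives [F] as the sum of [F] intersected with [S], closed
    by induction, and the line through [p]. *)
Lemma closed_subspace (n : nat) (e : 'I_n -> A) (F : set A) :
  F 0 -> (forall y z, F y -> F z -> F (y + z)) ->
  (forall (c : R[i]) y, F y -> F (c *: y)) ->
  (forall y, F y -> exists c : 'I_n -> R[i], y = \sum_i c i *: e i) ->
  closed (F : set (cstar_space A)).
Proof.
elim: n e F => [|n IH] e F F0 FD FZ Fspan.
  move=> x /cstar_closureP Fx; suff -> : x = 0 by [].
  apply: cstar_norm_small => d /Fx[p /Fspan[c ->]].
  by rewrite big_ord0 subr0.
pose S : set A := [set y | exists c : 'I_n -> R[i], y = \sum_i c i *: e (lift ord0 i)].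
have SD y z : S y -> S z -> S (y + z).
  move=> [c ->] [c' ->]; exists (fun i => c i + c' i); rewrite -big_split /=.
  by apply: eq_bigr => i _; rewrite scalerDl.
have SZ (a : R[i]) y : S y -> S (a *: y).
  move=> [c ->]; exists (fun i => a * c i); rewrite scaler_sumr.
  by apply: eq_bigr => i _; rewrite scalerA.
have S0 : S 0 by exists (fun=> 0); rewrite big1// => i _; rewrite scale0r.
have split y : F y -> exists (a : R[i]) (s : A), S s /\ y = a *: e ord0 + s.
  move=> /Fspan[c ->]; rewrite big_ord_recl; exists (c ord0).
  by eexists; split; last by []; exists (c \o lift ord0).
have [FS|/existsNP[p /not_implyP[Fp Sp]]] := pselect (forall y, F y -> S y).
  exact: IH FS.
have [a [s [Ss pE]]] := split _ Fp.
have a0 : a != 0.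
  by apply/eqP => a0; apply: Sp; rewrite pE a0 scale0r add0r.
suff -> : F = [set z | exists y (c : R[i]), (F `&` S) y /\ z = y + c *: p].
  apply: closed_line.
  - by [].
  - by move=> y z [Fy Sy] [Fz Sz]; split; [exact: FD|exact: SD].
  - by move=> c y [Fy Sy]; split; [exact: FZ|exact: SZ].
  - apply: (IH (e \o lift ord0)) => //.
    + by move=> y z [Fy Sy] [Fz Sz]; split; [exact: FD|exact: SD].
    + by move=> c y [Fy Sy]; split; [exact: FZ|exact: SZ].
    + by move=> y [].
apply/seteqP; split => [y Fy|y [z [c [[Fz _] ->]]]]; last first.
  by apply: FD => //; exact: FZ.
have [b [t [St yE]]] := split _ Fy.
(* The ratio [b / a] cancels the coefficient of [e ord0]. *)
exists (y - (b / a) *: p), (b / a); split; last by rewrite subrK.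
split; first by apply: FD => //; rewrite -scaleNr; exact: FZ.
have -> : y - (b / a) *: p = t + (- (b / a)) *: s.
  by rewrite yE pE scalerDr scalerA divfK// scaleNr opprD addrACA subrr add0r.
by apply: SD => //; exact: SZ.
Qed.

End finite_dimensional.

(** * Universal property of the algebraic tensor product *)

Record bimap (C : numClosedFieldType) (A B V : lmodType C) (f : A -> B -> V)
    : Prop := Bimap {
  bimapDl : forall a a' b, f (a + a') b = f a b + f a' b;
  bimapDr : forall a b b', f a (b + b') = f a b + f a b';
  bimapZl : forall (c : C) a b, f (c *: a) b = c *: f a b;
  bimapZr : forall (c : C) a b, f a (c *: b) = c *: f a b
}.

Section bimap_theory.
Context (C : numClosedFieldType) (A B V : lmodType C) (f : A -> B -> V).
Hypothesis fbi : bimap f.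

Lemma bimap0l b : f 0 b = 0.
Proof. by rewrite -(scale0r (0 : A)) (bimapZl fbi) scale0r. Qed.

Lemma bimap0r a : f a 0 = 0.
Proof. by rewrite -(scale0r (0 : B)) (bimapZr fbi) scale0r. Qed.

Lemma bimap_suml I (s : seq I) (F : I -> A) b :
  f (\sum_(i <- s) F i) b = \sum_(i <- s) f (F i) b.
Proof.
by rewrite (big_morph (fun x => f x b) (fun x y => bimapDl fbi x y b) (bimap0l b)).
Qed.

Lemma bimap_sumr I (s : seq I) (F : I -> B) a :
  f a (\sum_(i <- s) F i) = \sum_(i <- s) f a (F i).
Proof. by rewrite (big_morph (f a) (bimapDr fbi a) (bimap0r a)). Qed.

(** A linear relation with [c j] nonzero expresses [a j] through the other [a i], and bilinearity
    absorbs the [j]-th term into the others. The new terms do not depend on [f], so the same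
    elimination applies to [tens] and to any other bilinear map. *)
Lemma bimap_eliminate n (a : 'I_n.+1 -> A) (b : 'I_n.+1 -> B) (c : 'I_n.+1 -> C) j :
  \sum_i c i *: a i = 0 -> c j != 0 ->
  \sum_i f (a i) (b i) =
  \sum_i f (a (lift j i)) (b (lift j i) - (c (lift j i) / c j) *: b j).
Proof.
move=> ca0 cj; rewrite (bigD1_ord j) //=.
have -> : a j = \sum_i (- (c (lift j i) / c j)) *: a (lift j i).
  apply: (scalerI cj); apply/eqP; rewrite -subr_eq0 scaler_sumr -sumrN.
  rewrite -[X in _ == X]ca0 (bigD1_ord j) //=; apply/eqP; congr (_ + _).
  apply: eq_bigr => i _.
  by rewrite scalerA mulrN scaleNr opprK mulrC divfK.
rewrite bimap_suml -big_split /=; apply: eq_bigr => i _.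
by rewrite (bimapZl fbi) (bimapDr fbi) -(scaleNr _ (b j)) (bimapZr fbi) addrC.
Qed.

End bimap_theory.

Section tensor.
Context (C : numClosedFieldType) (A B T : cstarAlgType C) (tens : A -> B -> T).
Hypothesis tensP : cstar_tensor tens.

Lemma tens_bimap : bimap tens.
Proof.
by split; [exact: (tensDl tensP)|exact: (tensDr tensP)|exact: (tensZl tensP)
          |exact: (tensZr tensP)].
Qed.

(** Bilinear maps factor through the algebraic tensor product. By induction on the number of terms:
    if the left factors are independent, [tens_free] makes all right factors vanish; otherwise one
    term is eliminated on both sides. *)
Lemma tens_universal (V : lmodType C) (f : A -> B -> V) (s : seq (A * B)) :
  bimap f -> \sum_(p <- s) tens p.1 p.2 = 0 -> \sum_(p <- s) f p.1 p.2 = 0.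
Proof.
move=> fbi.
suff H n (a : 'I_n -> A) (b : 'I_n -> B) :
    \sum_i tens (a i) (b i) = 0 -> \sum_i f (a i) (b i) = 0.
  by rewrite !(big_nth (0, 0)) !big_mkord; exact: H.
elim: n a b => [|n IH] a b t0; first by rewrite !big_ord0.
have [free|/existsNP[c /not_implyP[ca0 /existsNP[j /eqP cj]]]] := pselect
    (forall c : 'I_n.+1 -> C, \sum_i c i *: a i = 0 -> forall i, c i = 0).
  by rewrite big1// => i _; rewrite (tens_free tensP free t0) bimap0r.
rewrite (bimap_eliminate fbi b ca0 cj) IH//.
by rewrite -(bimap_eliminate tens_bimap b ca0 cj).
Qed.

Lemma tens_universal_eq (V : lmodType C) (f : A -> B -> V) (s s' : seq (A * B)) :
  bimap f -> \sum_(p <- s) tens p.1 p.2 = \sum_(p <- s') tens p.1 p.2 ->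
  \sum_(p <- s) f p.1 p.2 = \sum_(p <- s') f p.1 p.2.
Proof.
move=> fbi e; apply/eqP; rewrite -subr_eq0; apply/eqP.
(* A difference of two sums is written as a single sum, the sign going into the first factor. *)
have negE (W : lmodType C) (g : A -> B -> W) : bimap g ->
    \sum_(p <- s) g p.1 p.2 - \sum_(p <- s') g p.1 p.2 =
    \sum_(p <- s ++ [seq (- p.1, p.2) | p <- s']) g p.1 p.2.
  move=> gbi; rewrite big_cat big_map -sumrN; congr (_ + _).
  by apply: eq_bigr => p _; rewrite -(scaleN1r p.1) [RHS](bimapZl gbi) !scaleN1r.
rewrite negE//; apply: tens_universal => //.
by rewrite -(negE _ _ tens_bimap) e subrr.
Qed.

End tensor.

(** * Finite sums of tensors as lists of pairs *)

Definition mul_pairs (A : pzSemiRingType) (s s' : seq (A * A)) : seq (A * A) :=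
  [seq (p.1 * q.1, p.2 * q.2) | p <- s, q <- s'].

Definition star_pairs (C : numClosedFieldType) (A : starAlgType C) (s : seq (A * A)) :
  seq (A * A) := [seq (star p.1, star p.2) | p <- s].

Section pair_sums.
Context (C : numClosedFieldType) (A T : starAlgType C).

Lemma big_mul_pairs (V : nmodType) (f : A * A -> V) s s' :
  \sum_(p <- mul_pairs s s') f p =
  \sum_(p <- s) \sum_(q <- s') f (p.1 * q.1, p.2 * q.2).
Proof. by rewrite /mul_pairs big_allpairs_dep. Qed.

Lemma big_star_pairs (f g : A * A -> T) s :
  (forall x y, f (star x, star y) = star (g (x, y))) ->
  \sum_(p <- star_pairs s) f p = star (\sum_(p <- s) g p).
Proof.
move=> fg; rewrite big_map star_sum; apply: eq_bigr => -[x y] _; exact: fg.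
Qed.

End pair_sums.

Section tensor_pairs.
Context (C : numClosedFieldType) (A T : cstarAlgType C) (tens : A -> A -> T).
Hypothesis tensP : cstar_tensor tens.

Lemma tens_mul_pairs s s' :
  \sum_(p <- mul_pairs s s') tens p.1 p.2 =
  (\sum_(p <- s) tens p.1 p.2) * (\sum_(p <- s') tens p.1 p.2).
Proof.
rewrite big_mul_pairs mulr_suml; apply: eq_bigr => p _.
by rewrite mulr_sumr; apply: eq_bigr => q _; rewrite (tensM tensP).
Qed.

Lemma tens_star_pairs s :
  \sum_(p <- star_pairs s) tens p.1 p.2 = star (\sum_(p <- s) tens p.1 p.2).
Proof.
by apply: (@big_star_pairs _ _ _ _ (fun p => tens p.1 p.2)) => x y; rewrite (tens_star tensP).
Qed.

End tensor_pairs.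

(** * Hopf algebra identities *)

Section hopf.
Context (R : realType) (N : nat) (G : cmqg R N).
Local Notation S := (@qS R N G).
Local Notation Delta := (@qDelta R N G).
Local Notation eps := (@qeps R N G).
Local Notation tens := (@qtens R N G).
Local Notation u := (@qu R N G).

(* The Hopf algebra identities satisfied by [a], where [s] lists the terms
   [x (x) y] of [Delta a]. The conditions [hopf_antl] and [hopf_antr] replace
   coassociativity combined with the antipode axiom, so that no threefold tensor
   product is needed; together with the others they are stable under products and
   stars. *)
Record hopf_pairs (a : G) (s : seq (G * G)) : Prop := HopfPairs {
  hopf_Delta : Delta a = \sum_(p <- s) tens p.1 p.2;
  hopf_antl : \sum_(p <- s) Delta p.1 * tens 1 (S p.2) = tens a 1;
  hopf_antr : \sum_(p <- s) tens 1 (S p.2) * Delta p.1 = tens a 1;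
  hopf_counitl : \sum_(p <- s) S p.2 * p.1 = eps a *: 1;
  hopf_counitr : \sum_(p <- s) p.1 * S p.2 = eps a *: 1;
  hopf_eps : \sum_(p <- s) eps p.1 *: p.2 = a;
  hopf_SS : S (S a) = a
}.

Lemma hopf_pairs1 : hopf_pairs 1 [:: (1, 1)].
Proof.
have tP := qtensP G.
split; rewrite ?big_seq1 /= ?rmorph1 ?qS1 ?mul1r ?mulr1 ?scale1r//.
by rewrite (tens1 tP).
Qed.

Lemma hopf_pairsD a b s t :
  hopf_pairs a s -> hopf_pairs b t -> hopf_pairs (a + b) (s ++ t).
Proof.
move=> [a1 a2 a3 a4 a5 a6 a7] [b1 b2 b3 b4 b5 b6 b7].
have tP := qtensP G.
split; rewrite ?big_cat /=.
- by rewrite raddfD /= a1 b1.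
- by rewrite a2 b2 (tensDl tP).
- by rewrite a3 b3 (tensDl tP).
- by rewrite a4 b4 raddfD scalerDl.
- by rewrite a5 b5 raddfD scalerDl.
- by rewrite a6 b6.
- by rewrite !raddfD /= a7 b7.
Qed.

Lemma hopf_pairsZ (c : R[i]) a s :
  hopf_pairs a s -> hopf_pairs (c *: a) [seq (c *: p.1, p.2) | p <- s].
Proof.
move=> [a1 a2 a3 a4 a5 a6 a7]; have tP := qtensP G.
split; rewrite ?big_map /=.
- rewrite linearZ /= a1 scaler_sumr; apply: eq_bigr => p _.
  by rewrite (tensZl tP).
- rewrite (tensZl tP) -a2 scaler_sumr; apply: eq_bigr => p _.
  by rewrite linearZ /= scalerAl.
- rewrite (tensZl tP) -a3 scaler_sumr; apply: eq_bigr => p _.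
  by rewrite linearZ /= scalerAr.
- rewrite linearZ /= -scalerA -a4 scaler_sumr; apply: eq_bigr => p _.
  by rewrite scalerAr.
- rewrite linearZ /= -scalerA -a5 scaler_sumr; apply: eq_bigr => p _.
  by rewrite scalerAl.
- rewrite -[in RHS]a6 scaler_sumr; apply: eq_bigr => p _.
  by rewrite linearZ /= scalerA.
- by rewrite !linearZ /= a7.
Qed.

Lemma hopf_pairsM a b s t :
  hopf_pairs a s -> hopf_pairs b t -> hopf_pairs (a * b) (mul_pairs s t).
Proof.
move=> [a1 a2 a3 a4 a5 a6 a7] [b1 b2 b3 b4 b5 b6 b7]; have tP := qtensP G.
have t1M x y : tens 1 (S (x * y)) = tens 1 (S y) * tens 1 (S x).
  by rewrite (tensM tP) mul1r qSM.
have epsM : eps (a * b) = (eps a : R[i]) * eps b by exact: rmorphM.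
split.
- by rewrite rmorphM /= a1 b1 (tens_mul_pairs tP).
- have -> : tens (a * b) 1 = tens a 1 * tens b 1 by rewrite (tensM tP) mulr1.
  rewrite big_mul_pairs -a2 mulr_suml; apply: eq_bigr => p _ /=.
  (* The two legs commute, so the whole sum for [b] can be collected between [Delta p.1] and
     [tens 1 (S p.2)]. *)
  rewrite -mulrA; have -> : tens 1 (S p.2) * tens b 1 = tens b 1 * tens 1 (S p.2).
    by rewrite !(tensM tP) !mulr1 !mul1r.
  rewrite -b2 mulr_suml mulr_sumr; apply: eq_bigr => q _.
  by rewrite rmorphM t1M /= !mulrA.
- have -> : tens (a * b) 1 = tens a 1 * tens b 1 by rewrite (tensM tP) mulr1.
  (* As the antipode reverses products, the terms of [a] are now the inner ones. *)
  rewrite big_mul_pairs exchange_big /= -b3 mulr_sumr; apply: eq_bigr => q _ /=.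
  have -> : tens a 1 * (tens 1 (S q.2) * Delta q.1) =
      tens 1 (S q.2) * tens a 1 * Delta q.1.
    by rewrite mulrA !(tensM tP) !mulr1 !mul1r.
  rewrite -a3 mulr_sumr mulr_suml; apply: eq_bigr => p _.
  by rewrite rmorphM t1M /= !mulrA.
- rewrite big_mul_pairs exchange_big /= epsM -scalerA -b4 scaler_sumr.
  apply: eq_bigr => q _; rewrite -[q.1 in RHS]mul1r scalerAr scalerAl -a4.
  rewrite mulr_suml mulr_sumr.
  by apply: eq_bigr => p _; rewrite qSM !mulrA.
- rewrite big_mul_pairs /= epsM mulrC -scalerA -a5 scaler_sumr.
  apply: eq_bigr => p _; rewrite -[p.1 in RHS]mulr1 scalerAl scalerAr -b5.
  rewrite mulr_sumr mulr_suml.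
  by apply: eq_bigr => q _; rewrite qSM !mulrA.
- rewrite big_mul_pairs -[in RHS]a6 mulr_suml; apply: eq_bigr => p _.
  rewrite -[in RHS]b6 mulr_sumr; apply: eq_bigr => q _.
  by rewrite rmorphM /= -scalerAl -scalerAr scalerA.
- by rewrite !qSM a7 b7.
Qed.

(** The star reverses products, so it exchanges [hopf_antl] with [hopf_antr] and [hopf_counitl] with
    [hopf_counitr]; this is why both versions are carried along. *)
Lemma hopf_pairs_star a s :
  hopf_pairs a s -> hopf_pairs (star a) (star_pairs s).
Proof.
move=> [a1 a2 a3 a4 a5 a6 a7]; have tP := qtensP G.
have sZ1 (c : R[i]) : star (c *: 1 : G) = c^* *: 1 by rewrite starZ star1.
split.
- by rewrite qDelta_star a1 (tens_star_pairs tP).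
- rewrite -{2}(star1 G) -(tens_star tP) -a3.
  apply: (@big_star_pairs _ _ _ _ (fun p => _ * Delta p.1)) => x y /=.
  by rewrite starM (tens_star tP) star1 qDelta_star qS_star.
- rewrite -{2}(star1 G) -(tens_star tP) -a2.
  apply: (@big_star_pairs _ _ _ _ (fun p => Delta p.1 * _)) => x y /=.
  by rewrite starM (tens_star tP) star1 qDelta_star qS_star.
- rewrite qeps_star -sZ1 -a5.
  apply: (@big_star_pairs _ _ _ _ (fun p => p.1 * S p.2)) => x y /=.
  by rewrite starM qS_star.
- rewrite qeps_star -sZ1 -a4.
  apply: (@big_star_pairs _ _ _ _ (fun p => S p.2 * p.1)) => x y /=.
  by rewrite starM qS_star.
- rewrite -[in RHS]a6.
  apply: (@big_star_pairs _ _ _ _ (fun p => eps p.1 *: p.2)) => x y /=.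
  by rewrite starZ qeps_star.
- by rewrite !qS_star a7.
Qed.

Lemma qu_sumr i j : \sum_k u i k * star (u j k) = (i == j)%:R.
Proof.
have /matrixP/(_ i j) := qu_unitaryr G; rewrite !mxE => <-.
by apply: eq_bigr => k _; rewrite !mxE.
Qed.

Lemma qu_suml i j : \sum_k star (u k i) * u k j = (i == j)%:R.
Proof.
have /matrixP/(_ i j) := qu_unitaryl G; rewrite !mxE => <-.
by apply: eq_bigr => k _; rewrite !mxE.
Qed.

Lemma qS_star_u i j : S (star (u i j)) = u j i.
Proof. by rewrite qS_star qS_u starK. Qed.

Lemma qS_nat n : S n%:R = n%:R.
Proof. by rewrite raddfMn; congr (_ *+ _); exact: qS1. Qed.

(* The antipode, being a morphism into the opposite algebra, turns the unitarity
   of [u] into that of its conjugate. *)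
Lemma qu_conj_suml i j : \sum_k star (u i k) * u j k = (i == j)%:R.
Proof.
rewrite eq_sym -qS_nat -qu_suml raddf_sum; apply: eq_bigr => k _ /=.
by rewrite qSM qS_star_u qS_u.
Qed.

(** Unitarity of [u] gives [hopf_antl] and [hopf_counitr]; that of its conjugate gives [hopf_antr]
    and [hopf_counitl]. *)
Lemma hopf_pairs_u i j :
  hopf_pairs (u i j) [seq (u i k, u k j) | k <- index_enum 'I_N].
Proof.
have tP := qtensP G; have tb := tens_bimap tP.
have dl (F : 'I_N -> G) (k : 'I_N) : \sum_l tens (F l) (l == k)%:R = tens (F k) 1.
  rewrite (bigD1 k) //= eqxx big1 ?addr0// => l /negbTE ->.
  by rewrite (bimap0r tb).
split; rewrite ?big_map /=.
- exact: qDelta_u.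
- rewrite -dl; under eq_bigr => k _ do rewrite qDelta_u mulr_suml.
  rewrite exchange_big; apply: eq_bigr => l _ /=.
  rewrite -qu_sumr (bimap_sumr tb); apply: eq_bigr => k _.
  by rewrite (tensM tP) mulr1 qS_u.
- rewrite -dl; under eq_bigr => k _ do rewrite qDelta_u mulr_sumr.
  rewrite exchange_big; apply: eq_bigr => l _ /=.
  rewrite eq_sym -qu_conj_suml (bimap_sumr tb); apply: eq_bigr => k _.
  by rewrite (tensM tP) mul1r qS_u.
- rewrite qeps_u scaler_nat eq_sym -qu_conj_suml; apply: eq_bigr => k _.
  by rewrite qS_u.
- rewrite qeps_u scaler_nat -qu_sumr; apply: eq_bigr => k _.
  by rewrite qS_u.
- rewrite (bigD1 i) //= qeps_u eqxx scale1r big1 ?addr0// => k.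
  by rewrite eq_sym qeps_u => /negbTE ->; rewrite scale0r.
- by rewrite qS_u qS_star_u.
Qed.

Lemma hopf_star_subalgebra : star_subalgebra [set a | exists s, hopf_pairs a s].
Proof.
split.
- by exists [:: (1, 1)]; exact: hopf_pairs1.
- by move=> x y [s xs] [t yt]; exists (s ++ t); exact: hopf_pairsD.
- by move=> x y [s xs] [t yt]; exists (mul_pairs s t); exact: hopf_pairsM.
- by move=> c x [s xs]; eexists; apply: hopf_pairsZ xs.
- by move=> x [s xs]; exists (star_pairs s); exact: hopf_pairs_star.
Qed.

(** The elements satisfying the identities form a star-subalgebra containing the generators. It is
    closed because the dimension is finite, hence it is everything. *)
Lemma finite_hopf_pairs : is_finite_qg G -> forall a : G, exists s, hopf_pairs a s.
Proof.
move=> [n [e espan]] a.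
have [P1 PD PM PZ Ps] := hopf_star_subalgebra.
have P0 : [set a | exists s, hopf_pairs a s] 0.
  by rewrite -(scale0r (1 : G)); exact: PZ.
have /seteqP[_ /(_ a I)] := qu_generate hopf_star_subalgebra
  (closed_subspace eps P0 PD PZ (fun y _ => espan y))
  (fun i j => ex_intro _ _ (hopf_pairs_u i j)).
exact.
Qed.

End hopf.

(** * Positive functionals and orthonormal families *)

Section positive_functional.
Context (C : numClosedFieldType) (A : starAlgType C) (h : {scalar A}).
Hypothesis h_ge0 : forall a : A, 0 <= h (star a * a).
Implicit Types a b : A.

Lemma positive_expand a b :
  h (star (a + b) * (a + b)) =
  h (star a * a) + h (star b * b) + (h (star a * b) + h (star b * a)).
Proof.
rewrite starD mulrDl !mulrDr !linearD /=.
by rewrite [h (star b * a) + _]addrC addrACA.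
Qed.

(** Expanding [h] at [1 + c *: a] shows that [c * h a + c^* * h (star a)] is real for every [c]; the
    values 1 and ['i] of [c] determine [h (star a)]. *)
Lemma positive_star a : h (star a) = (h a)^*.
Proof.
have real c : c * h a + c^* * h (star a) \is Num.real.
  have <- : h (star 1 * (c *: a)) + h (star (c *: a) * 1) = c * h a + c^* * h (star a).
    by rewrite star1 mul1r mulr1 starZ !linearZ.
  rewrite -[X in X \is _](addKr (h (star 1 * 1) + h (star (c *: a) * (c *: a)))).
  by rewrite -positive_expand rpredD ?rpredN ?rpredD ?ger0_real ?h_ge0.
have := real 1; rewrite rmorph1 !mul1r => /CrealP; rewrite rmorphD /= => e1.
have := real 'i; rewrite conjCi mulNr -mulrBr => /CrealP.
rewrite rmorphM /= conjCi rmorphB mulNr -mulrN => /(mulfI (neq0Ci _)).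
rewrite opprB => e2.
apply: (mulfI (_ : 2 != 0 :> C)); first by rewrite pnatr_eq0.
have -> : 2 * h (star a) = h a + h (star a) - (h a - h (star a)) by ring.
by rewrite -e1 -e2; ring.
Qed.

(** The kernel of the semi-inner product [h (star x * y)], which is linear in this form; [null_eltP]
    reduces membership to the vanishing of the seminorm. *)
Definition null_elt a := forall b, h (b * a) = 0.

Lemma null_eltP a : h (star a * a) = 0 -> null_elt a.
Proof.
move=> a0 b; apply/eqP; apply: contraT => w0; set w := h (b * a) in w0.
set q := h (star (star b) * star b).
have q0 : 0 <= q by exact: h_ge0.
(* With this [c], positivity at [star b + c *: a] reads [q - (q + 1) >= 0], which is absurd. *)
set c := - (q + 1) / (2 * w).
have cw : c * w = - (q + 1) / 2 by rewrite /c invfM mulrA divfK.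
have := h_ge0 (star b + c *: a); rewrite positive_expand -/q.
rewrite starZ -!scalerAl -!scalerAr !linearZ /= a0 !mulr0 addr0 starK -/w.
have -> : h (star a * star b) = w^* by rewrite -starM positive_star.
rewrite -rmorphM cw /=.
have -> : (- (q + 1) / 2)^* = - (q + 1) / 2.
  apply: conj_Creal; rewrite rpredM// ?rpredN ?rpredD ?rpredV ?realn ?ger0_real//.
by rewrite -splitr opprD addrA subrr add0r oppr_ge0 ler10.
Qed.

Lemma null_eltD a b : null_elt a -> null_elt b -> null_elt (a + b).
Proof. by move=> a0 b0 c; rewrite mulrDr linearD /= a0 b0 addr0. Qed.

Lemma null_eltZ (c : C) a : null_elt a -> null_elt (c *: a).
Proof. by move=> a0 b; rewrite -scalerAr linearZ /= a0 mulr0. Qed.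

Definition orthonormal n (e : 'I_n -> A) :=
  forall i j, h (star (e i) * e j) = (i == j)%:R.

(** For orthonormal [e], the orthogonal projection onto the span of [e]. *)
Definition onproj n (e : 'I_n -> A) a := \sum_i h (star (e i) * a) *: e i.

Lemma onprojD n (e : 'I_n -> A) a b : onproj e (a + b) = onproj e a + onproj e b.
Proof.
rewrite /onproj -big_split; apply: eq_bigr => i _ /=.
by rewrite mulrDr linearD scalerDl.
Qed.

Lemma onprojZ n (e : 'I_n -> A) (c : C) a : onproj e (c *: a) = c *: onproj e a.
Proof.
rewrite /onproj scaler_sumr; apply: eq_bigr => i _ /=.
by rewrite -scalerAr linearZ scalerA.
Qed.

Lemma onproj0 n (e : 'I_n -> A) : onproj e 0 = 0.
Proof. by have := onprojZ e 0 0; rewrite !scale0r. Qed.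

Lemma mul_onproj n (e : 'I_n -> A) a b :
  (forall i, h (b * e i) = 0) -> h (b * a) = h (b * (a - onproj e a)).
Proof.
move=> b0; rewrite mulrBr linearB /= mulr_sumr linear_sum big1 ?subr0//= => i _.
by rewrite -scalerAr linearZ /= b0 mulr0.
Qed.

Lemma mul_star_onproj n (e : 'I_n -> A) a i : orthonormal e ->
  h (star (e i) * (a - onproj e a)) = 0.
Proof.
move=> eo; rewrite mulrBr linearB /= mulr_sumr linear_sum (bigD1 i) //= big1.
  by rewrite -scalerAr linearZ /= eo eqxx mulr1 addr0 subrr.
by move=> j ji; rewrite -scalerAr linearZ /= eo eq_sym (negbTE ji) mulr0.
Qed.

(** One Gram-Schmidt step modulo null elements: the residue [r] of [x] is either null, and [e]
    already suffices, or it is normalized and added to the family. *)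
Lemma orthonormal_extend n (e : 'I_n -> A) (x : A) : orthonormal e ->
  exists (m : nat) (f : 'I_m -> A), orthonormal f /\
    (null_elt (x - onproj f x) /\
     forall y, null_elt (y - onproj e y) -> null_elt (y - onproj f y)).
Proof.
move=> eo; set r := x - onproj e x.
have [r0|r0] := eqVneq (h (star r * r)) 0.
  by exists n, e; split => //; split => //; exact: null_eltP.
have qp : 0 < h (star r * r) by rewrite lt0r r0 h_ge0.
pose s := sqrtC (h (star r * r)).
have sp : 0 < s by rewrite sqrtC_gt0.
have s0 : s != 0 by rewrite gt_eqF.
have s2 : h (star r * r) = s * s by rewrite -expr2 sqrtCK.
have sc : s^* = s by apply: conj_Creal; rewrite gtr0_real.
pose w := s^-1 *: r.
have wE a : h (star w * a) = s^-1 * h (star r * a).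
  by rewrite starZ rmorphV ?unitfE//= sc -scalerAl linearZ.
have re i : h (star (e i) * r) = 0 by exact: mul_star_onproj.
have er i : h (star r * e i) = 0.
  by rewrite -[star r * _]starK starM starK positive_star re rmorph0.
pose f (i : 'I_n.+1) := if unlift ord0 i is Some j then e j else w.
have f0 : f ord0 = w by rewrite /f unlift_none.
have fS j : f (lift ord0 j) = e j by rewrite /f liftK.
have pf a : onproj f a = h (star w * a) *: w + onproj e a.
  by rewrite /onproj big_ord_recl f0; under eq_bigr do rewrite fS.
exists n.+1, f; split; [|split].
- move=> i j; case: (unliftP ord0 i) => [i'|] ->; case: (unliftP ord0 j) => [j'|] ->.
  + by rewrite !fS eo (inj_eq lift_inj).
  + by rewrite fS f0 -scalerAr linearZ /= re mulr0.
  + by rewrite fS f0 wE er mulr0 (negbTE (neq_lift _ _)).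
  + by rewrite f0 wE -scalerAr linearZ /= s2 mulKf// mulVf.
- have -> : x - onproj f x = 0; last by move=> b; rewrite mulr0 linear0.
  rewrite pf wE (mul_onproj x er) -/r s2 mulKf//.
  by rewrite scalerA divff// scale1r opprD addrCA -/r addrC subrr.
(* The new coefficient of [y] vanishes: [r] is orthogonal to the family [e], so only the null
   residue of [y] contributes. *)
- move=> y y0; rewrite pf wE (mul_onproj y er) y0 mulr0 scale0r add0r.
  exact: y0.
Qed.

Lemma orthonormal_span n (x : 'I_n -> A) :
  exists (m : nat) (e : 'I_m -> A), orthonormal e /\
    forall i, null_elt (x i - onproj e (x i)).
Proof.
elim: n x => [|n IH] x.
  by exists 0, (fun=> 0); split => [[]|[]].
have [m [e [eo ex]]] := IH (fun i => x (lift ord0 i)).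
have [k [f [fo [f0 fe]]]] := orthonormal_extend (x ord0) eo.
exists k, f; split=> // i; case: (unliftP ord0 i) => [j|] -> //.
exact: fe.
Qed.

End positive_functional.

(** * Finite quantum groups *)

Section finite_haar.
Context (R : realType) (N : nat) (G : cmqg R N) (h : {scalar G}).
Hypotheses (hhaar : haar_state h) (Gfin : is_finite_qg G).
Local Notation S := (@qS R N G).
Local Notation Delta := (@qDelta R N G).
Local Notation eps := (@qeps R N G).
Local Notation tens := (@qtens R N G).
Let tP := qtensP G.
Let tb := tens_bimap tP.
Let h_ge0 := haar_state_ge0 hhaar.

Lemma qSK a : S (S a) = a.
Proof. by have [s []] := finite_hopf_pairs Gfin a. Qed.

(** Here [E] is h (x) id. Invariance gives E (Delta x (1 (x) y)) = h(x) y. Writing a (x) 1 as the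
    sum of the Delta a' (1 (x) S a''), over the terms a' (x) a'' of Delta a, turns the left side
    into the sum of the h(b a') S a''. *)
Lemma strong_invariance (E : {linear qalg2 G -> G}) a b :
  (forall a b, E (tens a b) = h a *: b) -> (forall a, E (Delta a) = h a *: 1) ->
  E (Delta b * tens a 1) = S (E (tens b 1 * Delta a)).
Proof.
move=> Et ED; have [s [aD <- _ _ _ _ _]] := finite_hopf_pairs Gfin a.
have Er x y : E (Delta x * tens 1 y) = h x *: y.
  have [t [xD _ _ _ _ _ _]] := finite_hopf_pairs Gfin x.
  rewrite -[y in RHS]mul1r scalerAl -ED xD mulr_suml !linear_sum mulr_suml /=.
  by apply: eq_bigr => p _; rewrite (tensM tP) mulr1 !Et scalerAl.
rewrite aD !mulr_sumr !linear_sum; apply: eq_bigr => p _ /=.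
by rewrite mulrA -rmorphM /= Er (tensM tP) mul1r Et linearZ.
Qed.

(* A null element [b] has [Delta b] in [null (x) G], by strong invariance and
   Gram-Schmidt modulo null elements. Applying [x (x) y |-> h (S y * x)] gives
   [eps b = 0], after which [b = (eps (x) id) (Delta b)] vanishes. *)
Lemma haar_state_faithful a : null_elt h a -> a = 0.
Proof.
have [n [x xspan]] := Gfin.
have [m [e [eo ex]]] := orthonormal_span h_ge0 x.
have nullp y : null_elt h (y - onproj h e y).
  have [c ->] := xspan y.
  have -> : \sum_i c i *: x i - onproj h e (\sum_i c i *: x i) =
      \sum_i c i *: (x i - onproj h e (x i)).
    rewrite (big_morph (onproj h e) (onprojD h e) (onproj0 h e)) -sumrB; apply: eq_bigr => i _.
    by rewrite onprojZ scalerBr.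
  apply: (big_ind (null_elt h)); first by move=> b; rewrite mulr0 linear0.
    by move=> b c'; exact: null_eltD.
  by move=> i _; apply: null_eltZ; exact: ex.
have [E [_ Et ED]] := haar_state_l hhaar.
have nullDelta b s : null_elt h b -> hopf_pairs b s ->
    Delta b = \sum_(p <- [seq (q.1 - onproj h e q.1, q.2) | q <- s]) tens p.1 p.2.
  move=> b0 [bD _ _ _ _ _ _].
  (* The slices of [Delta b] under [h (c * _)] vanish: by strong invariance their images under the
     injective [S] are sums of terms [h (p.1 * b) *: p.2], over the terms [p] of [Delta c]. *)
  have hs c : \sum_(p <- s) h (c * p.1) *: p.2 = 0.
    apply: (can_inj qSK); rewrite [RHS]linear0.
    have -> : \sum_(p <- s) h (c * p.1) *: p.2 = E (tens c 1 * Delta b).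
      rewrite bD mulr_sumr linear_sum; apply: eq_bigr => p _ /=.
      by rewrite (tensM tP) mul1r Et.
    rewrite -(strong_invariance _ _ Et ED).
    have [t [cD _ _ _ _ _ _]] := finite_hopf_pairs Gfin c.
    rewrite cD mulr_suml linear_sum big1// => p _ /=.
    by rewrite (tensM tP) Et b0 scale0r.
  rewrite bD big_map /=; apply/eqP; rewrite -subr_eq0 -sumrB.
  (* Replacing first legs by their residues changes [Delta b] by the tensors of the [e i] with such
     slices. *)
  have tE (p : G * G) : tens p.1 p.2 - tens (p.1 - onproj h e p.1) p.2 =
      \sum_i tens (e i) (h (star (e i) * p.1) *: p.2).
    rewrite -{1}(subrK (onproj h e p.1) p.1) (bimapDl tb) addrAC subrr add0r.
    rewrite (bimap_suml tb); apply: eq_bigr => i _.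
    by rewrite (bimapZl tb) (bimapZr tb).
  under eq_bigr do rewrite tE.
  rewrite exchange_big big1//= => i _.
  by rewrite -(bimap_sumr tb) hs (bimap0r tb).
have eps0 b : null_elt h b -> eps b = 0.
  move=> b0; have [s bs] := finite_hopf_pairs Gfin b.
  have fbi : @bimap _ G G R[i]^o (fun x y => h (S y * x)).
    split=> [y y' z|y z z'|c y z|c y z].
    - by rewrite mulrDr linearD.
    - by rewrite linearD mulrDl linearD.
    - by rewrite -scalerAr linearZ.
    - by rewrite linearZ /= -scalerAl linearZ.
  have := tens_universal_eq tP fbi
    (etrans (esym (hopf_Delta bs)) (nullDelta _ _ b0 bs)).
  rewrite big_map [X in _ = X -> _]big1 => [|p _]; last exact: nullp.
  rewrite -linear_sum (hopf_counitl bs) linearZ /= (haar_state1 hhaar).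
  by rewrite mulr1.
move=> a0; have [s bs] := finite_hopf_pairs Gfin a.
have fbi : @bimap _ G G G (fun x y => (eps x : R[i]) *: y).
  split=> [y y' z|y z z'|c y z|c y z].
  - by rewrite linearD scalerDl.
  - exact: scalerDr.
  - by rewrite linearZ scalerA.
  - by rewrite !scalerA mulrC.
have := tens_universal_eq tP fbi
  (etrans (esym (hopf_Delta bs)) (nullDelta _ _ a0 bs)).
rewrite (hopf_eps bs) => ->; rewrite big_map big1// => p _ /=.
by rewrite eps0// scale0r.
Qed.

Definition onbasis n (e : 'I_n -> G) :=
  orthonormal h e /\ forall a, a = \sum_i h (star (e i) * a) *: e i.

(** Gram-Schmidt on a spanning family leaves null residues, which vanish by faithfulness. *)
Lemma onbasis_exists : exists (n : nat) (e : 'I_n -> G), onbasis e.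
Proof.
have [n [x xspan]] := Gfin.
have [m [e [eo ex]]] := orthonormal_span h_ge0 x.
exists m, e; split => // a; have [c ->] := xspan a.
have xE i : x i = onproj h e (x i) by apply/subr0_eq/haar_state_faithful.
rewrite -[RHS]/(onproj h e _) (big_morph (onproj h e) (onprojD h e) (onproj0 h e)).
by apply: eq_bigr => i _; rewrite onprojZ -xE.
Qed.

(* With [Delta (e j) = \sum_i e i (x) v i j], invariance of [h] says that [v] is an
   isometry, and the antipode, by strong invariance, that so is its conjugate.
   Hence [Delta y = y (x) 1] for [y = \sum_i star (e i) * e i], so that [y] is
   scalar. *)
Lemma sum_onbasis n (e : 'I_n -> G) : onbasis e ->
  \sum_i star (e i) * e i = n%:R.
Proof.
move=> [eo eb].
have [E [_ Et ED]] := haar_state_l hhaar.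
have [F [_ Ft FD]] := haar_state_r hhaar.
(* The coefficient of [e i] in the first leg of [Delta (e j)]. *)
pose v i j := E (tens (star (e i)) 1 * Delta (e j)).
have De j : Delta (e j) = \sum_i tens (e i) (v i j).
  have [s [jD _ _ _ _ _ _]] := finite_hopf_pairs Gfin (e j).
  rewrite /v jD; under [RHS]eq_bigr do rewrite mulr_sumr linear_sum (bimap_sumr tb).
  rewrite [RHS]exchange_big; apply: eq_bigr => p _ /=.
  rewrite {1}(eb p.1) (bimap_suml tb); apply: eq_bigr => i _.
  by rewrite (tensM tP) mul1r Et (bimapZl tb) (bimapZr tb).
have Dse i : Delta (star (e i)) = \sum_k tens (star (e k)) (star (v k i)).
  by rewrite qDelta_star De star_sum; apply: eq_bigr => k _; rewrite (tens_star tP).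
have vv i j : \sum_k star (v k i) * v k j = (i == j)%:R.
  rewrite -scaler_nat -eo -ED rmorphM /= Dse De mulr_suml linear_sum.
  apply: eq_bigr => k _ /=.
  rewrite mulr_sumr linear_sum (bigD1 k) //= big1 => [|l lk].
    by rewrite (tensM tP) Et eo eqxx scale1r addr0.
  by rewrite (tensM tP) Et eo eq_sym (negbTE lk) scale0r.
have Sv i j : S (v i j) = star (v j i).
  rewrite -(strong_invariance _ _ Et ED) Dse mulr_suml linear_sum (bigD1 j) //=.
  rewrite big1 => [|k kj].
    by rewrite (tensM tP) Et eo eqxx scale1r addr0 mulr1.
  by rewrite (tensM tP) Et eo (negbTE kj) scale0r.
have vv' k l : \sum_i star (v k i) * v l i = (k == l)%:R.
  have Sn m : S m%:R = m%:R by rewrite raddfMn; congr (_ *+ _); exact: qS1.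
  rewrite eq_sym -Sn -vv linear_sum; apply: eq_bigr => i _ /=.
  by rewrite qSM qS_star !Sv starK.
set y := \sum_i _.
have Dy : Delta y = tens y 1.
  rewrite /y linear_sum (bimap_suml tb) /=.
  under eq_bigr => i _.
    rewrite rmorphM /= Dse De mulr_suml.
    under eq_bigr do rewrite mulr_sumr.
    over.
  rewrite exchange_big; apply: eq_bigr => k _ /=.
  rewrite exchange_big (bigD1 k) //= [X in _ + X]big1 => [|l lk].
    under eq_bigr do rewrite (tensM tP).
    by rewrite -(bimap_sumr tb) vv' eqxx addr0.
  under eq_bigr do rewrite (tensM tP).
  by rewrite -(bimap_sumr tb) vv' eq_sym (negbTE lk) (bimap0r tb).
have hy : h y = n%:R.
  rewrite linear_sum; under eq_bigr do rewrite eo eqxx.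
  by rewrite sumr_const card_ord.
(* Right invariance: id (x) h sends [Delta y] to [h y *: 1], and y (x) 1 to [y]. *)
have := FD y; rewrite Dy Ft hy (haar_state1 hhaar) scale1r => ->.
by rewrite scaler_nat.
Qed.

(** [h (star (e i) * (e i * x))] is a diagonal coefficient of right multiplication by [x], so
    [n%:R * h x] is the trace of that operator; the trace of a product of two operators does not
    depend on their order. *)
Lemma haar_tracial a b : h (a * b) = h (b * a).
Proof.
have [n [e be]] := onbasis_exists; have [eo eb] := be.
have n0 : n%:R != 0 :> R[i].
  rewrite pnatr_eq0; apply/eqP => n0; subst n.
  by have /eqP := eb 1; rewrite big_ord0 oner_eq0.
apply: (mulfI n0).
have hE x : n%:R * h x = \sum_i h (star (e i) * e i * x).
  by rewrite -linear_sum -mulr_suml sum_onbasis// !mulr_natl raddfMn.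
have hM x y : n%:R * h (x * y) =
    \sum_i \sum_j h (star (e j) * (e i * x)) * h (star (e i) * (e j * y)).
  rewrite hE; apply: eq_bigr => i _.
  have -> : star (e i) * e i * (x * y) = star (e i) * ((e i * x) * y).
    by rewrite !mulrA.
  rewrite {1}(eb (e i * x)) mulr_suml mulr_sumr linear_sum; apply: eq_bigr => j _ /=.
  by rewrite -scalerAl -scalerAr linearZ.
rewrite !hM exchange_big; apply: eq_bigr => i _; apply: eq_bigr => j _.
by rewrite mulrC.
Qed.

(** By traciality the stars of an orthonormal basis form an orthonormal basis, to which
    [sum_onbasis] applies. *)
Lemma sum_onbasis_star n (e : 'I_n -> G) : onbasis e ->
  \sum_i e i * star (e i) = n%:R.
Proof.
move=> [eo eb]; rewrite -(@sum_onbasis _ (fun i => star (e i))); last first.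
  split=> [i j|a]; first by rewrite starK haar_tracial eo eq_sym.
  rewrite -[LHS]starK [star a in LHS]eb star_sum; apply: eq_bigr => i _.
  rewrite starZ; congr (_ *: _).
  by rewrite -(positive_star h_ge0) starM !starK haar_tracial.
by apply: eq_bigr => i _; rewrite starK.
Qed.

End finite_haar.

(** * Morphisms into matrix algebras and the model in the finite case *)

Lemma lrmorphism_exists (C : numClosedFieldType) (A B : algType C) (f : A -> B) :
  linear f -> f 1 = 1 -> {morph f : x y / x * y} ->
  exists g : {lrmorphism A -> B}, forall x, g x = f x.
Proof.
move=> fl f1 fM.
pose g := HB.pack_for {lrmorphism A -> B} f
  (GRing.isLinear.Build C A B *:%R f fl)
  (GRing.isMonoidMorphism.Build A B f (f1, fM)).
by exists g.
Qed.

Lemma cintegral_cst (R : realType) (d : measure_display) (T : measurableType d)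
    (P : probability T R) (c : R[i]) :
  cintegral P (fun=> c) = c.
Proof.
by case: c => a b; rewrite /cintegral !Rintegral_cst//= probability_setT /= !mulr1.
Qed.

Lemma cfun_sumE (R : realType) (N : nat) (H : unitaryGroup R N) I (s : seq I)
    (F : I -> cfun H) (x : H) :
  cfun_fun (\sum_(i <- s) F i) x = \sum_(i <- s) cfun_fun (F i) x.
Proof. exact: (big_morph (fun g : cfun H => g x)). Qed.

Section trivial_group.
Context (R : realType).

Lemma mx0_eq (x y : 'M[R[i]]_0) : x = y.
Proof. by rewrite (flatmx0 x) (flatmx0 y). Qed.

(** Placed in U_0, where all matrices are equal, so that every group condition is immediate. *)
Definition trivial_group : unitaryGroup R 0.
Proof.
refine (@UnitaryGroup R 0 [set 1%:M] _ _ _ _ _).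
- by move=> x _; apply/unitarymxP; exact: mx0_eq.
- exact: mx0_eq.
- by move=> x y _ _; exact: mx0_eq.
- by move=> x _; exact: mx0_eq.
- exact: compact_set1.
Defined.

Lemma trivial_group_eq (x y : trivial_group) : x = y.
Proof. by apply: val_inj; exact: mx0_eq. Qed.

Lemma dirac_inv (x : trivial_group) (B : set (borel trivial_group)) :
  measurable B ->
  (dirac (ug1 trivial_group : borel trivial_group) : probability _ R) (ug_mul x @^-1` B) =
  (dirac (ug1 trivial_group : borel trivial_group) : probability _ R) B.
Proof.
move=> _; congr (dirac _ _); apply/seteqP.
by split=> y; rewrite /= (trivial_group_eq (ug_mul x y) y).
Qed.

Definition trivial_haar : haarGroup R 0 := HaarGroup dirac_inv.

End trivial_group.

Lemma finite_stationary (R : realType) (N : nat) (G : cmqg R N) (h : {scalar G}) :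
  haar_state h -> is_finite_qg G -> has_algebraic_stationary_model h.
Proof.
move=> hhaar Gfin; have h_ge0 := haar_state_ge0 hhaar.
have [[|k] [e be]] := onbasis_exists hhaar Gfin; have [eo eb] := be.
  by have /eqP := eb 1; rewrite big_ord0 oner_eq0.
pose H := trivial_haar R.
(* The matrix of left multiplication by [a] in the basis [e], with constant functions as entries. *)
pose f (a : G) : mxalg (cfun H) k :=
  \matrix_(i, j) cfun_cst H (h (star (e i) * a * e j)).
have fE a i j x : cfun_fun (f a i j) x = h (star (e i) * a * e j) by rewrite mxE.
have fP (m m' : mxalg (cfun H) k) :
    (forall i j x, cfun_fun (m i j) x = cfun_fun (m' i j) x) -> m = m'.
  by move=> mm'; apply/matrixP => i j; apply: cfunP => x; exact: mm'.
have [||| pi piE] := @lrmorphism_exists _ G (mxalg (cfun H) k) f.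
- move=> c a b; apply: fP => i j x; rewrite fE mulrDr mulrDl linearD /=.
  rewrite -scalerAr -scalerAl linearZ /=; symmetry.
  rewrite /f !mxE; reflexivity.
- apply: fP => i j x; rewrite fE mulr1 eo mxE; by case: eqP.
- move=> a b; apply: fP => i j x; rewrite fE mxE cfun_sumE.
  (* Expanding [b * e j] in the basis produces the matrix product. *)
  rewrite (mulrA (star (e i)) a b) -(mulrA _ b) (eb (b * e j)) mulr_sumr linear_sum.
  apply: eq_bigr => l _; rewrite -scalerAr linearZ /= mulrC mulrA.
  by rewrite /f !mxE.
exists k, 0, H, pi; split.
- move=> a; rewrite !piE; apply: fP => i j x; rewrite fE.
  transitivity (cfun_fun (f a j i) x)^*; last by rewrite !mxE.
  by rewrite fE -(positive_star h_ge0) !starM starK mulrA.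
- move=> a b; rewrite !piE => ab.
  have {}ab i j : h (star (e i) * a * e j) = h (star (e i) * b * e j).
    by rewrite -!(fE _ _ _ (ug1 H)) ab.
  have abe j : a * e j = b * e j.
    rewrite (eb (a * e j)) (eb (b * e j)); apply: eq_bigr => i _.
    by rewrite !mulrA ab.
  rewrite -[a]mulr1 -[b]mulr1 (eb 1) !mulr_sumr; apply: eq_bigr => j _.
  by rewrite -!scalerAr abe.
- move=> a; rewrite /tr_haar piE.
  rewrite [X in cintegral _ X](_ : _ = fun=> h a); first by rewrite cintegral_cst.
  apply/funext => x; rewrite /mxtrace; under eq_bigr do rewrite !mxE /=.
  (* Traciality turns each diagonal entry into [h (a * (e i * star (e i)))], and these sum to [k.+1]
     times [h a]. *)
  under eq_bigr do rewrite -mulrA (haar_tracial hhaar Gfin) -mulrA.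
  rewrite -linear_sum -mulr_sumr /= (sum_onbasis_star hhaar Gfin be) mulr_natr.
  by rewrite raddfMn /= -(mulr_natl (h a)) mulKf// pnatr_eq0.
Qed.

(** * The Haar integral of a compact Lie group *)

Section complex_topology.
Context (R : realType).

(** Reduces integrals of imaginary parts to integrals of real parts. *)
Lemma Im_Re (z : R[i]) : complex.Im z = complex.Re (- 'i%C * z).
Proof. by case: z => a b /=; rewrite !(oppr0, mul0r, mulN1r) sub0r opprK. Qed.

Lemma normc_real (x : R) : `|x%:C%C| = `|x|%:C%C.
Proof. by rewrite normc_def /= expr0n addr0 sqrtr_sqr. Qed.

Lemma Re_continuous : continuous (@complex.Re R : R[i] -> R).
Proof.
move=> z B /nbhs_ballP[e /= e0 eB].
apply/(@nbhs_ballP R[i] R[i]^o); exists e%:C%C; first by rewrite /= ltcR.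
move=> w; rewrite -ball_normE /= => zw; apply: eB; rewrite -ball_normE /=.
rewrite -ltcR; apply: le_lt_trans zw; rewrite -raddfB; exact: normc_ge_Re.
Qed.

Lemma real_complex_continuous : continuous (real_complex R : R -> R[i]).
Proof.
move=> x B /(@nbhs_ballP R[i] R[i]^o)[e /= e0 eB].
have [r _ er] := real_complex_ge0 (ltW e0).
apply/nbhs_ballP; exists r; first by move: e0; rewrite er ltcR.
move=> y; rewrite -ball_normE /= => xy; apply: eB; rewrite -ball_normE /=.
by rewrite -rmorphB normc_real er ltcR.
Qed.

End complex_topology.

Section haar_integral.
Context (R : realType) (N : nat) (L : haarGroup R N).

Lemma continuous_measurable (f : L -> R) : continuous f ->
  measurable_fun setT (f : borel L -> R).
Proof.
move=> fc; apply: (measurability _ (measurable_realfun.RGenOpens.measurableE R)).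
move=> _ [_ [x [y ->]] <-]; rewrite setTI; apply: sub_sigma_algebra.
by move/continuousP: fc; apply; exact: interval_open.
Qed.

Lemma set_val_continuous (i j : 'I_N) :
  continuous (fun x : L => set_val x i j : R[i]).
Proof.
move=> x B Bx.
have nB : nbhs (set_val x : 'M[R[i]]_N) [set M | B (M i j)].
  exists (fun i' j' => if (i' == i) && (j' == j) then B else setT).
    move=> i' j'; case: ifP => [/andP[/eqP -> /eqP ->]//|_]; exact: filterT.
  by move=> M /(_ i j); rewrite !eqxx.
exact: (@initial_continuous (set_type (ug_set L)) _ set_val x _ nB).
Qed.

(** The topology of [L] is induced by the matrix entries, and the entries of the product with [x]
    are linear combinations of the continuous coordinate functions. *)
Lemma ug_mul_continuous (x : L) : continuous (ug_mul x : L -> L).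
Proof.
apply: (@continuous_comp_initial (set_type (ug_set L)) L _ set_val (ug_mul x)).
move=> y B [P My sPB].
pose c i j : cfun L := \sum_k set_val x i k *: mkcfun (@set_val_continuous k j).
have cE i j z : c i j z = set_val (ug_mul x z) i j.
  rewrite /c cfun_sumE [RHS]mxE; apply: eq_bigr => k _; exact: erefl.
have Pc i j : \forall z \near y, P i j (c i j z).
  have := @cfun_continuous _ _ _ (c i j) y (P i j); apply.
  by rewrite -[cfun_fun _ _]/(c i j y) cE; exact: My.
have : \forall z \near y, forall i j, P i j (c i j z).
  apply: (@filter_forall L 'I_N (fun i z => forall j, P i j (c i j z)) (nbhs y)) => i.
  by apply: (@filter_forall L 'I_N (fun j z => P i j (c i j z)) (nbhs y)) => j; exact: Pc.
apply: filterS => z Pz; apply: sPB => i j; rewrite -cE; exact: Pz.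
Qed.

Lemma ug_mul_measurable (x : L) :
  measurable_fun setT (ug_mul x : borel L -> borel L).
Proof.
apply: (@measurability _ _ (borel L) (borel L) setT (ug_mul x) (@open L) erefl).
move=> _ [B oB <-]; rewrite setTI; apply: sub_sigma_algebra.
by move/continuousP: (@ug_mul_continuous x); apply.
Qed.

Lemma Re_measurable (f : cfun L) :
  measurable_fun setT (fun x : borel L => complex.Re (f x)).
Proof.
apply: continuous_measurable => x; apply: continuous_comp.
  exact: cfun_continuous.
exact: Re_continuous.
Qed.

Lemma haar_setT : haar L setT = 1%E.
Proof. exact: probability_setT. Qed.

(** Discharged by [lie_cfun_bounded], where the bound is the norm of the corresponding element of
    C(G). *)
Hypothesis cfun_bounded : forall f : cfun L, exists M : R, forall x, `|f x| <= M%:C%C.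

Lemma Re_integrable (f : cfun L) :
  (haar L).-integrable setT (EFin \o (fun x => complex.Re (f x))).
Proof.
apply: measurable_bounded_integrable => //.
- by rewrite [X in (X < _)%E](_ : _ = 1%E) ?ltry//; exact: haar_setT.
- exact: Re_measurable.
- have [M fM] := cfun_bounded f; exists M; split; first exact: num_real.
  move=> M' MM' x _; apply: le_trans (ltW MM'); rewrite -lecR.
  by apply: le_trans (fM x); exact: normc_ge_Re.
Qed.

Definition haar_int (f : cfun L) : R[i] := cintegral (haar L) f.

Lemma haar_intE (f : cfun L) :
  haar_int f = (\int[haar L]_x complex.Re (f x) +i*
                \int[haar L]_x complex.Re ((- 'i%C *: f) x))%C.
Proof.
rewrite /haar_int /cintegral; congr Complex.
by apply: eq_Rintegral => x _; rewrite Im_Re.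
Qed.

Lemma haar_intD (f g : cfun L) : haar_int (f + g) = haar_int f + haar_int g.
Proof.
have ReD (u v : cfun L) x : complex.Re ((u + v) x) = complex.Re (u x) + complex.Re (v x).
  by rewrite [(u + v) x]/(u x + v x) raddfD.
rewrite !haar_intE scalerDr; congr Complex; rewrite -RintegralD//;
  try exact: Re_integrable; apply: eq_Rintegral => x _; exact: ReD.
Qed.

Lemma Re_intZ (p : R) (f : cfun L) :
  \int[haar L]_x complex.Re ((p%:C%C *: f) x) = p * \int[haar L]_x complex.Re (f x).
Proof.
rewrite -RintegralZl//; last exact: Re_integrable.
apply: eq_Rintegral => x _; rewrite [(_ *: f) x]/(p%:C%C * f x).
by case: (f x) => a b /=; rewrite mul0r subr0.
Qed.

(** First for real scalars, then for the imaginary unit, then by [c] = a + i b and additivity. *)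
Lemma haar_intZ (c : R[i]) (f : cfun L) : haar_int (c *: f) = c * haar_int f.
Proof.
have real p (g : cfun L) : haar_int (p%:C%C *: g) = p%:C%C * haar_int g.
  rewrite !haar_intE scalerA mulrC -scalerA !Re_intZ.
  by apply/eqP; rewrite eq_complex /= !mul0r subr0 addr0 !eqxx.
have imag (g : cfun L) : haar_int ('i%C *: g) = 'i%C * haar_int g.
  rewrite !haar_intE scalerA mulNr -expr2 sqr_i opprK scale1r.
  have -> : 'i%C *: g = (-1)%:C%C *: (- 'i%C *: g).
    by rewrite scalerA rmorphN1 mulN1r opprK.
  rewrite Re_intZ.
  by apply/eqP; rewrite eq_complex /= !mul0r mulN1r !mul1r sub0r add0r !eqxx.
rewrite {1}[c]complexE scalerDl haar_intD -scalerA imag !real.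
by rewrite [c in RHS]complexE mulrDl mulrA.
Qed.

(** The factor 2 comes from bounding the real and imaginary parts separately; the density argument
    only needs some constant. *)
Lemma haar_int_le (f : cfun L) (M : R) : (forall x, `|f x| <= M%:C%C) ->
  `|haar_int f| <= 2 * M%:C%C.
Proof.
move=> fM.
have ReM (g : cfun L) : (forall x, `|g x| <= M%:C%C) ->
    `|\int[haar L]_x complex.Re (g x)| <= M.
  move=> gM; apply: le_trans (le_normr_Rintegral _ (Re_integrable g)) _ => //.
  apply: (@le_trans _ _ (\int[haar L]_x (cst M x))).
    apply: le_Rintegral => //.
    - exact: (integrable_norm (Re_integrable g)).
    - exact: finite_measure_integrable_cst.
    - by move=> x _; rewrite -lecR; apply: le_trans (gM x); exact: normc_ge_Re.
  by rewrite Rintegral_cst// [X in fine X](_ : _ = 1%E) ?mulr1//; exact: haar_setT.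
rewrite haar_intE [X in `|X|]complexE /=; apply: (le_trans (ler_normD _ _)).
rewrite mulr_natl mulr2n; apply: lerD.
  by rewrite normc_real lecR ReM.
rewrite normrM normc_real.
have i1 : `|'i%C : R[i]| = 1.
  by rewrite normc_def /= expr0n expr1n add0r sqrtr1.
rewrite i1 mul1r lecR; apply: ReM => x.
by change (`|- 'i%C * f x| <= M%:C%C); rewrite normrM normrN i1 mul1r.
Qed.

(** Left invariance says that the Haar measure is its own pushforward under translation by [x]; the
    rest is change of variables. *)
Lemma haar_int_inv (x : L) (f g : cfun L) :
  (forall y, g y = f (ug_mul x y)) -> haar_int g = haar_int f.
Proof.
move=> gf; rewrite !haar_intE.
pose mul_x : {mfun borel L >-> borel L} := HB.pack (ug_mul x : borel L -> borel L)
  (isMeasurableFun.Build _ _ _ _ _ (ug_mul_measurable x)).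
have inv (u v : cfun L) : (forall y, v y = u (ug_mul x y)) ->
    \int[haar L]_y complex.Re (v y) = \int[haar L]_y complex.Re (u y).
  move=> uv; congr fine.
  transitivity (\int[pushforward (haar L) mul_x]_y
     (complex.Re (u y))%:E)%E; last first.
    by apply: eq_measure_integral => B mB _; exact: (haar_inv x mB).
  rewrite integral_pushforward//.
  - by apply: eq_integral => y _ /=; rewrite uv.
  - apply: (measurable_realfun.measurable_EFinP _ _).2; exact: Re_measurable.
  - rewrite preimage_setT (_ : _ \o _ = EFin \o (fun y => complex.Re (v y))).
      exact: Re_integrable.
    by apply/funext => y /=; rewrite uv.
congr Complex; apply: inv => // y.
by change (- 'i%C * g y = - 'i%C * f (ug_mul x y)); rewrite gf.
Qed.

End haar_integral.

(** * Compact Lie groups *)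

Section lie.
Context (R : realType) (N : nat) (G : cmqg R N) (h : {scalar G}).
Context (L : haarGroup R N) (theta : {lrmorphism G -> cfun L}).
Hypotheses (hhaar : haar_state h) (theta_star : {morph theta : a / star a >-> star a})
  (theta_bij : bijective theta)
  (theta_u : forall i j (x : L), cfun_fun (theta (qu G i j)) x = set_val x i j).
Let tP := qtensP G.
Let h_ge0 := haar_state_ge0 hhaar.

(** Evaluation at [x] after [theta] is a character. *)
Lemma theta_bounded a (x : L) : `|cfun_fun (theta a) x| <= cstar_norm a.
Proof.
have [||| chi chiE] := @lrmorphism_exists _ G R[i]^o (fun a => cfun_fun (theta a) x).
- by move=> c y z; rewrite linearP.
- by rewrite rmorph1.
- by move=> y z; rewrite rmorphM.
by rewrite -chiE; exact: character_bounded.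
Qed.

Lemma theta_star_mul a b : theta (star a * b) = star (theta a) * theta b.
Proof. by rewrite -theta_star; exact: rmorphM. Qed.

Lemma cstar_norm_real (a : G) : exists2 M : R, 0 <= M & cstar_norm a = M%:C%C.
Proof. exact/real_complex_ge0/cstar_norm_ge0. Qed.

Lemma lie_cfun_bounded (f : cfun L) : exists M : R, forall x, `|f x| <= M%:C%C.
Proof.
have [inv _ thetaK] := theta_bij; have [M _ e] := cstar_norm_real (inv f).
by exists M => x; rewrite -e -{1}(thetaK f); exact: theta_bounded.
Qed.

(** With [M] the norm of [a] and [f] its function, the square root of M^2 - |f|^2 is continuous, so
    M^2 - [star a * a] has the form [star b * b] and [h (star a * a)] is at most M^2. *)
Lemma haar_state_bounded a : `|h a| <= cstar_norm a.
Proof.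
have [M M0 aM] := cstar_norm_real a; have [inv _ thetaK] := theta_bij.
pose f := theta a.
pose g : cfun L := f * star f.
pose q (x : L) : R := M ^+ 2 - complex.Re (cfun_fun g x).
have gE x : cfun_fun g x = (complex.Re (cfun_fun g x))%:C%C /\
    complex.Re (cfun_fun g x) <= M ^+ 2.
  have [r r0 re] := real_complex_ge0 (normr_ge0 (cfun_fun f x)).
  have gx : cfun_fun g x = (r ^+ 2)%:C%C.
    transitivity (cfun_fun f x * (cfun_fun f x)^*); first by [].
    by rewrite -normCK re rmorphXn.
  rewrite gx; split=> //=; rewrite ler_sqr ?nnegrE//.
  by rewrite -lecR -re -aM; exact: theta_bounded.
have qc : continuous (fun x : L => (Num.sqrt (q x))%:C%C : R[i]).
  move=> x; apply: (@continuous_comp L R R[i] (fun x => Num.sqrt (q x))).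
    apply: (@continuous_comp L R R q); last exact: sqrt_continuous.
    have Reg : continuous (fun y : L => complex.Re (cfun_fun g y)).
      move=> y; apply: (@continuous_comp L R[i] R (cfun_fun g)).
        exact: cfun_continuous.
      exact: Re_continuous.
    exact: (@cvgB R R^o L (nbhs x) _ (fun=> M ^+ 2) _ _ _ (cvg_cst _) (Reg x)).
  exact: real_complex_continuous.
pose b := inv (mkcfun qc).
have bE : star b * b = (M%:C%C ^+ 2) *: 1 - star a * a.
  apply: (bij_inj theta_bij); apply: cfunP => x; rewrite theta_star_mul thetaK.
  transitivity ((Num.sqrt (q x))%:C%C^* * (Num.sqrt (q x))%:C%C); first by [].
  rewrite conj_Creal; last by apply/complex_realP; exists (Num.sqrt (q x)).
  have [gx leM] := gE x.
  have qE : (q x)%:C%C = M%:C%C ^+ 2 - cfun_fun g x.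
    by rewrite [in RHS]gx -rmorphXn -rmorphB.
  transitivity ((Num.sqrt (q x) ^+ 2)%:C%C); first by rewrite rmorphXn.
  rewrite sqr_sqrtr ?subr_ge0// qE.
  have -> : theta (M%:C%C ^+ 2 *: 1 - star a * a) = M%:C%C ^+ 2 *: 1 - g.
    by rewrite linearB linearZ /= theta_star_mul (rmorph1 theta) [star _ * _]mulrC.
  by congr (_ - _); exact: esym (mulr1 _).
have haa : h (star a * a) <= M%:C%C ^+ 2.
  have := h_ge0 b; rewrite bE linearB linearZ /= (haar_state1 hhaar) mulr1.
  by rewrite subr_ge0.
(* The variance of [a] is nonnegative, so the square of [|h a|] is at most [h (star a * a)]. *)
have := h_ge0 (a - h a *: 1).
have -> : h (star (a - h a *: 1) * (a - h a *: 1)) = h (star a * a) - `|h a| ^+ 2.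
  rewrite -scaleNr positive_expand starZ star1 -!scalerAl -!scalerAr !mul1r !mulr1.
  rewrite !linearZ /= (haar_state1 hhaar) (positive_star h_ge0) normCK rmorphN.
  by ring.
rewrite subr_ge0 aM => /le_trans/(_ haa).
by rewrite ler_pXn2r ?nnegrE ?normr_ge0// lecR.
Qed.

(** The elements whose coproduct is a finite sum of tensors that represents the function (x, y) |->
    a(xy). In general [qDelta] takes values in a completion, so the comparison with the group law
    starts from these elements. *)
Definition lie_pairs : set G := [set a | exists s : seq (G * G),
  qDelta G a = \sum_(p <- s) qtens p.1 p.2 /\
  forall x y : L, cfun_fun (theta a) (ug_mul x y) =
    \sum_(p <- s) cfun_fun (theta p.1) x * cfun_fun (theta p.2) y].

Lemma lie_pairs_star_subalgebra : star_subalgebra lie_pairs.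
Proof.
split.
- exists [:: (1, 1)]; rewrite big_seq1 rmorph1 (tens1 tP); split=> // x y.
  by rewrite big_seq1 !rmorph1 [RHS]mulr1.
- move=> a b [s [Ds ts]] [t [Dt tt]]; exists (s ++ t).
  rewrite big_cat /= rmorphD /= Ds Dt; split=> // x y.
  by rewrite big_cat /= rmorphD -ts -tt.
- move=> a b [s [Ds ts]] [t [Dt tt]]; exists (mul_pairs s t).
  rewrite (tens_mul_pairs tP) rmorphM /= Ds Dt; split=> // x y.
  transitivity (cfun_fun (theta a) (ug_mul x y) * cfun_fun (theta b) (ug_mul x y)).
    by rewrite rmorphM.
  rewrite big_mul_pairs ts tt mulr_suml.
  apply: eq_bigr => p _; rewrite mulr_sumr; apply: eq_bigr => q _ /=.
  by rewrite !rmorphM; exact: mulrACA.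
- move=> c a [s [Ds ts]]; exists [seq (c *: p.1, p.2) | p <- s].
  rewrite big_map linearZ /= Ds scaler_sumr; split=> [|x y].
    by apply: eq_bigr => p _; rewrite (tensZl tP).
  transitivity (c * cfun_fun (theta a) (ug_mul x y)); first by rewrite linearZ.
  rewrite big_map ts mulr_sumr; apply: eq_bigr => p _ /=.
  by rewrite linearZ; exact: mulrA.
- move=> a [s [Ds ts]]; exists (star_pairs s).
  rewrite (tens_star_pairs tP) qDelta_star Ds; split=> // x y.
  transitivity (cfun_fun (theta a) (ug_mul x y))^*; first by rewrite theta_star.
  rewrite big_map ts rmorph_sum /=.
  by apply: eq_bigr => p _; rewrite !theta_star rmorphM.
Qed.

Lemma lie_pairs_u i j : lie_pairs (qu G i j).
Proof.
exists [seq (qu G i k, qu G k j) | k <- index_enum 'I_N].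
rewrite big_map qDelta_u; split=> // x y; rewrite big_map theta_u [LHS]mxE.
by apply: eq_bigr => k _; rewrite !theta_u.
Qed.

Lemma haar_int_theta_sum (I : Type) (s : seq I) (c : I -> R[i]) (f : I -> cfun L) :
  haar_int (\sum_(i <- s) c i *: f i) = \sum_(i <- s) c i * haar_int (f i).
Proof.
have bd := lie_cfun_bounded.
have int0 : haar_int (0 : cfun L) = 0.
  by rewrite -(scale0r (0 : cfun L)) (haar_intZ bd) mul0r.
rewrite (big_morph _ (haar_intD bd) int0); apply: eq_bigr => i _.
exact: haar_intZ.
Qed.

Lemma haar_state_lie_pairs a : lie_pairs a -> h a = haar_int (theta a).
Proof.
have bd := lie_cfun_bounded.
have [E [_ Et ED]] := haar_state_l hhaar.
move=> [s [Ds ts]].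
have key : \sum_(p <- s) haar_int (theta p.2) *: p.1 = haar_int (theta a) *: 1.
  apply: (bij_inj theta_bij); apply: cfunP => x.
  rewrite linear_sum linearZ rmorph1 cfun_sumE [RHS]mulr1 /=.
  (* At [x], the left side of the identity is the integral of [g], the left translate of [theta a]
     by [x]. *)
  pose g := \sum_(p <- s) cfun_fun (theta p.1) x *: theta p.2.
  have gE y : cfun_fun g y = cfun_fun (theta a) (ug_mul x y).
    by rewrite cfun_sumE ts.
  rewrite -(haar_int_inv bd gE) haar_int_theta_sum; apply: eq_bigr => p _.
  by rewrite linearZ; exact: mulrC.
have int1 : haar_int (1 : cfun L) = 1 by exact: cintegral_cst.
have -> : haar_int (theta a) = h (haar_int (theta a) *: 1).
  by rewrite linearZ /= (haar_state1 hhaar) mulr1.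
(* The left side [h a] becomes the integral of [theta (E (qDelta G a))], by invariance of [h]. *)
rewrite -key linear_sum -[LHS]mulr1 -int1 -(haar_intZ bd) -(rmorph1 theta).
rewrite -linearZ -ED Ds linear_sum linear_sum.
under eq_bigr do rewrite /= Et linearZ.
rewrite haar_int_theta_sum; apply: eq_bigr => p _.
by rewrite linearZ; exact: mulrC.
Qed.

Lemma haar_state_integral a : h a = haar_int (theta a).
Proof.
have bd := lie_cfun_bounded.
have /seteqP[_ /(_ a I)/cstar_closureP cla] := qu_generate
  (closure_star_subalgebra lie_pairs_star_subalgebra) (@closed_closure _ _)
  (fun i j => subset_closure (lie_pairs_u i j)).
apply/eqP; rewrite -subr_eq0 -normr_eq0; apply: contraT => d0.
set d := `|_| in d0.
have dp : 0 < d by rewrite lt0r d0 normr_ge0.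
(* The 3 is 1 + 2, the bounds for [h] and for the Haar integral. *)
have [p Pp ap] := cla (d / 3) (divr_gt0 dp (ltr0n _ 3)).
have : d < d; last by rewrite ltxx.
have dE : d = `|h (a - p) - haar_int (theta (a - p))|.
  rewrite /d; congr `|_|; rewrite linearB (raddfB theta) -(scaleN1r (theta p)) (haar_intD bd).
  rewrite (haar_intZ bd) mulN1r (haar_state_lie_pairs Pp) /=.
  by rewrite opprB addrA subrK.
rewrite {1}dE; apply: (le_lt_trans (ler_normB _ _)).
have [M _ Me] := cstar_norm_real (a - p).
have := haar_int_le bd (f := theta (a - p)) (M := M).
rewrite -Me => /(_ (theta_bounded _)) le2.
apply: (le_lt_trans (lerD (haar_state_bounded _) le2)).
rewrite -{1}[cstar_norm _]mul1r -mulrDl -[1 + 2](natrD _ 1 2) mulrC.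
by move: ap; rewrite ltr_pdivlMr.
Qed.

End lie.

Lemma lie_stationary (R : realType) (N : nat) (G : cmqg R N) (h : {scalar G}) :
  haar_state h -> is_compact_lie G -> has_algebraic_stationary_model h.
Proof.
move=> hhaar [L [theta [theta_star theta_bij theta_u]]].
(* Index 0 stands for matrices of size 1. *)
pose f (a : G) : mxalg (cfun L) 0 := const_mx (theta a).
have [||| pi piE] := @lrmorphism_exists _ G (mxalg (cfun L) 0) f.
- by move=> c a b; apply/matrixP => i j; rewrite !mxE linearP.
- by apply/matrixP => i j; rewrite !mxE rmorph1 !ord1.
- by move=> a b; apply/matrixP => i j; rewrite !mxE big_ord1 !mxE rmorphM.
exists 0, N, L, pi; split.
- by move=> a; rewrite !piE; apply/matrixP => i j; rewrite !mxE theta_star.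
- move=> a b; rewrite !piE => /matrixP/(_ 0 0); rewrite !mxE.
  exact: bij_inj.
- move=> a; rewrite (haar_state_integral hhaar theta_star theta_bij theta_u).
  rewrite /tr_haar piE; congr (cintegral _ _); apply/funext => x.
  by rewrite invr1 mul1r /mxtrace big_ord1 !mxE.
Qed.

Theorem proposition2p2 (R : realType) (N : nat) (G : cmqg R N) (h : {scalar G})
  (hhaar : haar_state h) (hG : is_compact_lie G \/ is_finite_qg G) :
  has_algebraic_stationary_model h.
Proof.
by case: hG => [Glie|Gfin]; [exact: lie_stationary|exact: finite_stationary].
Qed.
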